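(* The formula $$\langle F,G\rangle_{\mathcal{W}_{res}}=\frac{i}{8\pi^2}\int_{\widetilde\Gamma}\mathrm{Tr}\bigl(F(Z)\cdot G(Z)\bigr)\,dZ^3,\qquad F\in\mathcal{W}'_{res},\ G\in\mathcal{W}^*_{res},$$ defines a non-degenerate bilinear pairing between the $\mathfrak{sp}(4,\mathbb{C})$-modules $(\rho'_2,\mathcal{W}'_{res})$ and $(\rho^*_2,\mathcal{W}^*_{res})$, and this pairing is $\mathfrak{sp}(4,\mathbb{C})$-invariant.
   Context: Let $Z=\begin{pmatrix} z_{11} & z_{12} \\ z_{12} & z_{22} \end{pmatrix}$ denote a complex symmetric $2\times2$ matrix, $z_{12}=it$; use coordinates $z_{11},z_{22},t$; $N(Z)=\det Z=z_{11}z_{22}+t^2$. $P=\mathbb{C}[z_{11},z_{12},z_{22},N(Z)^{-1}]$; $N(Z)^{1/2}P$ is the corresponding space with half-integer powers of $N(Z)$. $\partial=\begin{pmatrix} \partial_{z_{11}} & -\frac i2\partial_t \\ -\frac i2\partial_t & \partial_{z_{22}} \end{pmatrix}$. $\mathfrak{sp}(4,\mathbb{C})=\{\begin{pmatrix} A & B \\ C & -A^T \end{pmatrix}:B^T=B,\,C^T=C\}$ ($2\times2$ blocks); $A,B,C$ stand for $\begin{pmatrix} A & 0 \\ 0 & -A^T \end{pmatrix}$, $\begin{pmatrix} 0 & B \\ 0 & 0 \end{pmatrix}$, $\begin{pmatrix} 0 & 0 \\ C & 0 \end{pmatrix}$. $\mathcal{W}'_{res}=\mathrm{Mat}_2(\mathbb{C})\otimes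 P$ with $\rho'_2(A)F=-\mathrm{Tr}(AZ\partial+ZA^T\partial+2A)F+AF+FA^T$, $\rho'_2(B)F=-\mathrm{Tr}(B\partial)F$, $\rho'_2(C)F=\mathrm{Tr}(ZCZ\partial+2ZC)F-ZCF-FCZ$. $\mathcal{W}^*_{res}=\mathrm{Mat}_2(\mathbb{C})\otimes N(Z)^{1/2}P$ with $\rho^*_2(A)G=-\mathrm{Tr}(AZ\partial+ZA^T\partial+A)G-GA-A^TG$, $\rho^*_2(B)G=-\mathrm{Tr}(B\partial)G$, $\rho^*_2(C)G=\mathrm{Tr}(ZCZ\partial+ZC)G+CZG+GZC$. $\widetilde\Gamma=S^2\times S^1$, where $S^2=\{X=\begin{pmatrix} z & it \\ it & \bar z \end{pmatrix}:z\in\mathbb{C},t\in\mathbb{R},\det X=1\}$ and $S^1=\{\zeta\in\mathbb{C}:|\zeta|=1\}$; functions are pulled back to $\widetilde\Gamma$ via $(X,\zeta)\mapsto Z=\zeta X$, with $N(Z)^{1/2}=\zeta$. $dZ^3=dz^0\wedge dz^1\wedge dz^3$, where $z_{11}=z^0-iz^3$, $z_{22}=z^0+iz^3$, $z_{12}=-iz^1$. $\widetilde\Gamma$ is oriented so that at $(1,1)$ the tangent vectors $\frac{1}{i}\begin{pmatrix} 1 & 0 \\ 0 & 1 \end{pmatrix}$, $\begin{pmatrix} 0 & -i \\ -i & 0 \end{pmatrix}$, $\begin{pmatrix} -i & 0 \\ 0 & i \end{pmatrix}$ (in this order) form a positive basis. Invariance means $\langle\rho'_2(X)F,G\rangle+\langle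 F,\rho^*_2(X)G\rangle=0$ for all $X$. *)

(* Defs.v *)
From HB Require Import structures.
From mathcomp Require Import all_boot all_order all_algebra.
From mathcomp Require Import complex ring.
From mathcomp Require Import all_classical all_reals all_analysis.

Set Implicit Arguments.
Unset Strict Implicit.
Unset Printing Implicit Defensive.

Import Order.TTheory GRing.Theory Num.Theory.
Import numFieldNormedType.Exports.

Local Open Scope classical_set_scope.
Local Open Scope ring_scope.

Section Defs.
Variable R : realType.
Local Notation C := R[i].
Local Notation M2 := 'M[C]_2.

Definition mx2 (a b c d : C) : M2 :=
  \matrix_(i, j) (if i == ord0 then if j == ord0 then a else b
                  else if j == ord0 then c else d).

(* Elements of P and of N^(1/2) P are handled as regular functions on the
   nonsingular symmetric matrices.  They are represented by functions on all of
   M2, whose values outside [regular_dom] are irrelevant. *)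
Definition regular_dom (Z : M2) : Prop := Z^T = Z /\ \det Z != 0.

(* C[z11, z12, z22, N(Z)^-1], as the algebra of functions on [regular_dom]
   generated by the constants, the entries of Z and N(Z)^-1. *)
Inductive inP : (M2 -> C) -> Prop :=
| inP_const (c : C) : inP (fun _ => c)
| inP_entry (i j : 'I_2) : inP (fun Z => Z i j)
| inP_invN : inP (fun Z => (\det Z)^-1)
| inP_add f g : inP f -> inP g -> inP (fun Z => f Z + g Z)
| inP_mul f g : inP f -> inP g -> inP (fun Z => f Z * g Z)
| inP_ext f g : (forall Z, regular_dom Z -> f Z = g Z) -> inP f -> inP g.

(* W'_res = Mat_2(C) (x) P. *)
Definition inW' (F : M2 -> M2) : Prop :=
  forall i j, inP (fun Z => F Z i j).

(* W*_res = Mat_2(C) (x) N^(1/2) P.  An element G = N^(1/2) g is represented by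
   its cofactor g, with entries in P. *)
Definition inWs (g : M2 -> M2) : Prop :=
  forall i j, inP (fun Z => g Z i j).

(* 'D_v is the complex directional derivative.  In the coordinates z11, z22, t
   with z12 = i t, the partial derivatives are those along E11, E22 and
   i (E12 + E21). *)
Definition d11 (f : M2 -> C) (Z : M2) : C := 'D_(mx2 1 0 0 0) (f : M2 -> C^o) Z.
Definition d22 (f : M2 -> C) (Z : M2) : C := 'D_(mx2 0 0 0 1) (f : M2 -> C^o) Z.
Definition dt (f : M2 -> C) (Z : M2) : C := 'D_(mx2 0 'i 'i 0) (f : M2 -> C^o) Z.

Definition dmx (f : M2 -> C) (Z : M2) : M2 :=
  mx2 (d11 f Z) (- ('i / 2) * dt f Z) (- ('i / 2) * dt f Z) (d22 f Z).

(* The same operator on N^(1/2) P, read on cofactors: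
   d (N^(1/2) g) = N^(1/2) (d g + 1/2 N^-1 g dN). *)
Definition dmx_half (g : M2 -> C) (Z : M2) : M2 :=
  dmx g Z + (2^-1 * (\det Z)^-1 * g Z) *: dmx (fun W => \det W) Z.

(* Consistency with an actual branch r of N^(1/2) near Z. *)
Lemma dmx_branch (r g : M2 -> C^o) (Z : M2) :
  (forall v, derivable r Z v) -> (forall v, derivable g Z v) ->
  (\forall W \near (Z : 'M[C^o]_2), r W ^+ 2 = \det W) -> \det Z != 0 ->
  dmx (fun W => r W * g W) Z = r Z *: dmx_half g Z.
Proof.
move=> dr dg rN N0.
have rZ : r Z ^+ 2 = \det Z by exact: nbhs_singleton rN.
have rZ0 : r Z != 0 by apply: contraNneq N0 => r0; rewrite -rZ r0 expr0n.
have key v : 'D_v ((fun W => r W * g W) : M2 -> C^o) Z =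
    r Z * ('D_v g Z + 2^-1 * (\det Z)^-1 * g Z *
                      'D_v ((fun W => \det W) : M2 -> C^o) Z).
  have -> : 'D_v ((fun W => \det W) : M2 -> C^o) Z = 2 * r Z * 'D_v r Z.
    transitivity ('D_v (r * r) Z).
      apply: near_eq_derive => //.
      by near=> W; rewrite -[RHS]expr2; apply/esym; near: W.
    by rewrite deriveM// /GRing.scale/=; move: ('D_v r Z) => x; move: (r Z) => y; ring.
  rewrite (_ : (fun W => r W * g W) = r * g)// deriveM// -rZ /GRing.scale/=.
  move: rZ0 ('D_v r Z) ('D_v g Z) (g Z); move: (r Z) => y y0 x u w.
  by field.
rewrite /dmx_half /dmx /d11 /d22 /dt !key.
move: (2^-1 * (\det Z)^-1 * g Z) (r Z) => k y.
do 3![move: ('D_(mx2 _ _ _ _) g Z) => ?].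
do 3![move: ('D_(mx2 _ _ _ _) _ Z) => ?].
by apply/matrixP => i j; rewrite !mxE; case: ifP => _; case: ifP => _; ring.
Unshelve. all: by end_near.
Qed.

(* Tr(M d) F, applied entrywise, for d one of [dmx] and [dmx_half]. *)
Definition trd (d : (M2 -> C) -> M2 -> M2) (M : M2) (F : M2 -> M2) (Z : M2)
  : M2 := \matrix_(i, j) \tr (M *m d (fun W => F W i j) Z).

Definition rho'A (A : M2) (F : M2 -> M2) (Z : M2) : M2 :=
  - (trd dmx (A *m Z) F Z + trd dmx (Z *m A^T) F Z + \tr (2 *: A) *: F Z)
  + A *m F Z + F Z *m A^T.
Definition rho'B (B : M2) (F : M2 -> M2) (Z : M2) : M2 :=
  - trd dmx B F Z.
Definition rho'C (K : M2) (F : M2 -> M2) (Z : M2) : M2 :=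
  trd dmx (Z *m K *m Z) F Z + \tr (2 *: (Z *m K)) *: F Z
  - Z *m K *m F Z - F Z *m K *m Z.

Definition rhosA (A : M2) (g : M2 -> M2) (Z : M2) : M2 :=
  - (trd dmx_half (A *m Z) g Z + trd dmx_half (Z *m A^T) g Z + \tr A *: g Z)
  - g Z *m A - A^T *m g Z.
Definition rhosB (B : M2) (g : M2 -> M2) (Z : M2) : M2 :=
  - trd dmx_half B g Z.
Definition rhosC (K : M2) (g : M2 -> M2) (Z : M2) : M2 :=
  trd dmx_half (Z *m K *m Z) g Z + \tr (Z *m K) *: g Z
  + K *m Z *m g Z + g Z *m Z *m K.

Definition sp4 (X : 'M[C]_(2 + 2)) : Prop :=
  exists A B K : M2, [/\ B^T = B, K^T = K & X = block_mx A B K (- A^T)].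

Definition rho' (X : 'M[C]_(2 + 2)) (F : M2 -> M2) (Z : M2) : M2 :=
  rho'A (ulsubmx X) F Z + rho'B (ursubmx X) F Z + rho'C (dlsubmx X) F Z.
Definition rhos (X : 'M[C]_(2 + 2)) (g : M2 -> M2) (Z : M2) : M2 :=
  rhosA (ulsubmx X) g Z + rhosB (ursubmx X) g Z + rhosC (dlsubmx X) g Z.

(* Coordinates z^0, z^1, z^3 of a symmetric matrix:
   z11 = z^0 - i z^3, z22 = z^0 + i z^3, z12 = - i z^1. *)
Definition zcoord (Z : M2) : 'rV[C]_3 :=
  \row_(k < 3) [:: (Z ord0 ord0 + Z ord_max ord_max) / 2;
                   'i * Z ord0 ord_max;
                   'i * (Z ord0 ord0 - Z ord_max ord_max) / 2]`_k.

(* The 3-form dz^0 /\ dz^1 /\ dz^3 on three tangent vectors. *)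
Definition dZ3 (v1 v2 v3 : M2) : C :=
  \det (\matrix_(k < 3, l < 3) zcoord [:: v1; v2; v3]`_k ord0 l).

Definition cexpi (x : R) : C := (cos x +i* sin x)%C.

(* X = (z, it; it, zbar) with z = sin th e^(i ph), t = cos th: for 0 <= th <= pi
   and - pi <= ph <= pi this covers S^2, injectively off a null set. *)
Definition S2pt (th ph : R) : M2 :=
  mx2 ((sin th)%:C%C * cexpi ph) ('i * (cos th)%:C%C)
      ('i * (cos th)%:C%C) ((sin th)%:C%C * cexpi (- ph)).

Definition Gpt (al th ph : R) : M2 := cexpi al *: S2pt th ph.

Definition cderive (u : R -> C) (x : R) : C :=
  (derive1 (fun y => complex.Re (u y) : R^o) x +i*
   derive1 (fun y => complex.Im (u y) : R^o) x)%C.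
Definition mxderive (u : R -> M2) (x : R) : M2 :=
  \matrix_(i, j) cderive (fun y => u y i j) x.

(* dZ^3 pulled back to the parameters, evaluated on (d/d al, d/d th, d/d ph).
   S^2 x S^1 is oriented by declaring positive at (1, 1) the basis
     v1 = - i 1,  v2 = (0, -i; -i, 0),  v3 = (-i, 0; 0, i).
   The point (1, 1) has parameters (0, pi/2, 0), where the three parameter
   tangent vectors are - v1, v2, - v3: their order is thus the positive one. *)
Definition jac (al th ph : R) : C :=
  dZ3 (mxderive (fun a => Gpt a th ph) al)
      (mxderive (fun a => Gpt al a ph) th)
      (mxderive (fun a => Gpt al th a) ph).

Definition cint (a b : R) (u : R -> C) : C :=
  ((\int[lebesgue_measure]_(x in `[a, b]) complex.Re (u x)) +i*
   (\int[lebesgue_measure]_(x in `[a, b]) complex.Im (u x)))%C.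

(* Integral over S^2 x S^1 of h dZ^3, with h given on points (zeta, Z), where
   zeta = N(Z)^(1/2). *)
Definition Gint (h : C -> M2 -> C) : C :=
  cint (- pi) pi (fun al => cint 0 pi (fun th => cint (- pi) pi (fun ph =>
    h (cexpi al) (Gpt al th ph) * jac al th ph))).

(* [g] is the cofactor of G = N^(1/2) g, so G(Z) = zeta g(Z). *)
Definition pairing (F g : M2 -> M2) : C :=
  'i / (8 * pi%:C%C ^+ 2) *
  Gint (fun zeta Z => \tr (F Z *m (zeta *: g Z))).

End Defs.

(* Main.v *)
Require Import Defs.
From mathcomp Require Import all_boot all_order all_algebra.
From mathcomp Require Import complex ring lra zify.
From mathcomp Require Import all_classical all_reals all_analysis.

(* On the cycle, with Z = zeta X, the form dZ^3 is - i zeta^3 sin th in the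
   parameters, so that <F, G> is a multiple of the integral of
   zeta^4 sin th Tr(F g).

   Non-degeneracy: on the cycle the conjugates of z11, z12, z22, N^-1 are
   z22 / N, - z12 / N, z11 / N, N, so the conjugate of f in P is again (the
   restriction of) an element of P; integrating f against N^-2 times it gives
   the integral of |f|^2 sin th.  Hence f vanishes on the cycle.  Along a complex
   line of symmetric matrices f is a polynomial divided by a power of N, hence it
   is zero as soon as it has infinitely many zeros: in this way the vanishing
   spreads from the cycle to C^* S^2, which contains an open set of the real
   points of the coordinates (z^0, z^1, z^3), and then to all Z, one coordinate
   at a time.

   Invariance: with f = Tr(F g) and W = Z C Z - A Z - Z A^T - B, one has
   Tr(rho'(X) F g) + Tr(F rho^*(X) g) = sum_v N^(-1/2) d_v (N^(1/2) W_v f) over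
   the three coordinate directions v, the zeroth order terms of the two actions
   adding up to div W = 3 Tr(Z C - A).  Each summand integrates to zero; by
   linearity this has to be checked on the monomials z11^a z22^b z12^c N^-k, where
   it amounts to the recurrences satisfied by the integrals of sin^p cos^q. *)

Import Order.TTheory GRing.Theory Num.Theory.
Import numFieldNormedType.Exports.
Local Open Scope classical_set_scope.
Local Open Scope ring_scope.
Set Implicit Arguments.
Unset Strict Implicit.
Unset Printing Implicit Defensive.

(** * Integrals over an interval *)

Section RealIntegrals.
Variable R : realType.
Notation mu := (@lebesgue_measure R).
Implicit Types (a b : R) (u f F : R -> R).

Lemma continuous_integrable_itv u a b : continuous u ->
  mu.-integrable `[a, b] (EFin \o u).
Proof.
move=> cu; apply: continuous_compact_integrable; first exact: segment_compact.
exact: continuous_subspaceT.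
Qed.

Lemma Rintegral_derive f F a b : a <= b -> continuous f ->
  (forall x : R, is_derive x 1 F (f x)) ->
  \int[mu]_(x in `[a, b]) f x = F b - F a.
Proof.
rewrite le_eqVlt => /predU1P[<- _ _|ab cf dF].
  by rewrite subrr set_itv1 /Rintegral integral_set1.
have cF : continuous F.
  move=> x; apply: differentiable_continuous; apply/derivable1_diffP.
  by have [] := dF x.
rewrite /Rintegral (@continuous_FTC2 _ f F)//.
- exact: continuous_subspaceT.
- split.
  + by move=> x _; have [] := dF x.
  + by apply: cvg_at_right_filter; exact: cF.
  + by apply: cvg_at_left_filter; exact: cF.
- by move=> x _; rewrite derive1E; have [] := dF x.
Qed.

(** If u x were positive, u would exceed u x / 2 on a whole segment around x, and that segment alone
    would give the integral a positive lower bound. *)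
Lemma continuous_ge0_Rintegral_eq0 u a b : continuous u ->
  (forall x, a <= x <= b -> 0 <= u x) ->
  \int[mu]_(x in `[a, b]) u x = 0 -> forall x, a < x < b -> u x = 0.
Proof.
move=> cu u0 I0 x /andP[ax xb].
apply/eqP; rewrite eq_le u0 ?(ltW ax) ?(ltW xb)// andbT leNgt; apply/negP => ux.
have : \forall y \near x, u x / 2 < u y.
  have h : u x / 2 < u x by rewrite ltr_pdivrMr// ltr_pMr// ltr1n.
  exact: (cvgr_gt (u x) (cu x)) h.
case => e /= e0 he.
(* This radius keeps the closed segment around x strictly inside the ball of radius e and inside
   [a, b]. It is positive because x is an interior point. *)
pose d := Num.min (e / 2) (Num.min (x - a) (b - x)).
have d0 : 0 < d by rewrite !lt_min divr_gt0//= !subr_gt0 ax.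
have de : d < e.
  by rewrite /d gt_min ltr_pdivrMr// ltr_pMr// ltr1n.
have da : d <= x - a by rewrite /d !ge_min lexx orbT.
have db : d <= b - x by rewrite /d !ge_min lexx !orbT.
have sub : `[x - d, x + d] `<=` (`[a, b] : set R).
  move=> y /=; rewrite !in_itv/= => /andP[h1 h2]; apply/andP; split; lra.
have iu c c' := continuous_integrable_itv c c' cu.
have cc : continuous (cst (u x / 2) : R -> R) by move=> ?; exact: cst_continuous.
have le1 : \int[mu]_(y in `[x - d, x + d]) (u x / 2) <=
           \int[mu]_(y in `[x - d, x + d]) u y.
  apply: le_Rintegral => //.
    exact: continuous_integrable_itv cc.
  move=> y /=; rewrite in_itv/= => /andP[h1 h2]; apply/ltW/he => /=.
  by rewrite ltr_distlC; apply/andP; split; lra.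
have le2 : \int[mu]_(y in `[x - d, x + d]) u y <= \int[mu]_(y in `[a, b]) u y.
  rewrite /Rintegral fine_le//.
  - by apply: integrable_fin_num => //; exact: iu.
  - by apply: integrable_fin_num => //; exact: iu.
  - apply: ge0_subset_integral => //.
    by have /integrableP[] := iu a b.
have := le_trans le1 le2; rewrite I0 Rintegral_cst//.
have -> : fine (mu `[x - d, x + d]) = d + d.
  have := @lebesgue_measure_itv R `[x - d, x + d]; rewrite /= lte_fin.
  have -> : x - d < x + d by lra.
  by move=> ->; rewrite -EFinD /=; ring.
apply/negP; rewrite -ltNge mulr_gt0 ?divr_gt0//; lra.
Qed.

End RealIntegrals.

(** * Continuity, derivatives and integrals of complex functions of a real variable *)

Section ComplexIntegrals.
Variable R : realType.
Local Notation C := R[i].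
Implicit Types (u v : R -> C) (a b : R).

(** Continuity and differentiation are taken by real and imaginary parts, to match [cint] and
    [cderive]; real analysis then applies to each part. *)
Definition ccont u := continuous (fun x => complex.Re (u x)) /\
  continuous (fun x => complex.Im (u x)).

Definition is_cderive u (x : R) (d : C) :=
  is_derive x 1 (fun y => complex.Re (u y) : R^o) (complex.Re d) /\
  is_derive x 1 (fun y => complex.Im (u y) : R^o) (complex.Im d).

Lemma ReD (x y : C) : complex.Re (x + y) = complex.Re x + complex.Re y.
Proof. by case: x; case: y. Qed.
Lemma ImD (x y : C) : complex.Im (x + y) = complex.Im x + complex.Im y.
Proof. by case: x; case: y. Qed.
Lemma ReM (x y : C) : complex.Re (x * y) =
  complex.Re x * complex.Re y - complex.Im x * complex.Im y.
Proof. by case: x; case: y. Qed.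
Lemma ImM (x y : C) : complex.Im (x * y) =
  complex.Re x * complex.Im y + complex.Im x * complex.Re y.
Proof. by case: x; case: y. Qed.
Lemma complex_eq (x y : C) : complex.Re x = complex.Re y ->
  complex.Im x = complex.Im y -> x = y.
Proof. by case: x; case: y => /= ? ? ? ? -> ->. Qed.

Lemma ccont_cst (c : C) : ccont (fun=> c).
Proof. by split => x; exact: cst_continuous. Qed.

Lemma ccontD u v : ccont u -> ccont v -> ccont (fun x => u x + v x).
Proof.
move=> [u1 u2] [v1 v2]; split => x.
  under eq_fun do rewrite ReD; apply: continuousD; [exact: u1|exact: v1].
under eq_fun do rewrite ImD; apply: continuousD; [exact: u2|exact: v2].
Qed.

Lemma ccontM u v : ccont u -> ccont v -> ccont (fun x => u x * v x).
Proof.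
move=> [u1 u2] [v1 v2]; split => x.
  under eq_fun do rewrite ReM.
  apply: cvgB; apply: cvgM;
    [exact: u1|exact: v1|exact: u2|exact: v2].
under eq_fun do rewrite ImM.
apply: cvgD; apply: cvgM;
  [exact: u1|exact: v2|exact: u2|exact: v1].
Qed.

Lemma is_cderive_cst (c : C) x : is_cderive (fun=> c) x 0.
Proof. by split; exact: is_derive_cst. Qed.

Lemma is_cderiveM u v x du dv : is_cderive u x du -> is_cderive v x dv ->
  is_cderive (fun x => u x * v x) x (du * v x + u x * dv).
Proof.
move=> [u1 u2] [v1 v2]; split.
  under eq_fun do rewrite ReM.
  apply: (is_derive_eq (is_deriveB (is_deriveM u1 v1) (is_deriveM u2 v2))).
  by rewrite ReD !ReM /GRing.scale/=; ring.
under eq_fun do rewrite ImM.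
apply: (is_derive_eq (is_deriveD (is_deriveM u1 v2) (is_deriveM u2 v1))).
by rewrite ImD !ImM /GRing.scale/=; ring.
Qed.

Lemma is_cderiveX u x du n : is_cderive u x du ->
  is_cderive (fun x => u x ^+ n) x (n%:R * u x ^+ n.-1 * du).
Proof.
move=> hu; elim: n => [|n ih].
  by rewrite mul0r mul0r; under eq_fun do rewrite expr0; exact: is_cderive_cst.
have := is_cderiveM hu ih; under eq_fun do rewrite -exprS.
suff -> : du * u x ^+ n + u x * (n%:R * u x ^+ n.-1 * du) =
  n.+1%:R * u x ^+ n.+1.-1 * du by [].
case: n {ih} => [|n] /=; first by rewrite !expr0; ring.
by rewrite !exprS; ring.
Qed.

Lemma is_cderive_eq (u : R -> C) x d d' : is_cderive u x d -> d = d' ->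
  is_cderive u x d'.
Proof. by move=> h <-. Qed.

Lemma is_cderive_val u x du : is_cderive u x du -> cderive u x = du.
Proof.
move=> [h1 h2]; rewrite /cderive !derive1E.
by apply: complex_eq => /=; [have [_ ->] := h1|have [_ ->] := h2].
Qed.

Lemma is_cderive_cont u (du : R -> C) : (forall x, is_cderive u x (du x)) -> ccont u.
Proof.
move=> h; split => x; apply: differentiable_continuous; apply/derivable1_diffP.
  by have [[]] := h x.
by have [_ []] := h x.
Qed.

Lemma is_cderive_sin x :
  is_cderive (fun x => (sin x)%:C%C) x (cos x)%:C%C.
Proof. by split => /=; [exact: is_derive_sin|exact: is_derive_cst]. Qed.

Lemma is_cderive_cos x :
  is_cderive (fun x => (cos x)%:C%C) x (- sin x)%:C%C.
Proof. by split => /=; [exact: is_derive_cos|exact: is_derive_cst]. Qed.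

Lemma is_cderive_cexpi x : is_cderive (@cexpi R) x ('i%C * cexpi x).
Proof.
split => /=; rewrite !mul0r !mul1r ?sub0r ?add0r.
  exact: is_derive_cos.
exact: is_derive_sin.
Qed.

Lemma cintD a b u v : ccont u -> ccont v ->
  cint a b (fun x => u x + v x) = cint a b u + cint a b v.
Proof.
move=> [u1 u2] [v1 v2]; have ci := continuous_integrable_itv a b.
rewrite /cint; apply: complex_eq; rewrite ?ReD ?ImD /=.
  by under eq_Rintegral do rewrite ReD; rewrite RintegralD//; exact: ci.
by under eq_Rintegral do rewrite ImD; rewrite RintegralD//; exact: ci.
Qed.

Lemma cintZ a b (c : C) u : ccont u ->
  cint a b (fun x => c * u x) = c * cint a b u.
Proof.
move=> [u1 u2]; have ci := continuous_integrable_itv a b.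
have cZ (k : R) (w : R -> R) : continuous w -> continuous (fun x => k * w x).
  by move=> cw x; apply: continuousM; [exact: cst_continuous|exact: cw].
rewrite /cint; apply: complex_eq; rewrite ?ReM ?ImM /=.
  under eq_Rintegral do rewrite ReM.
  by rewrite RintegralB ?RintegralZl//; apply: ci => //; exact: cZ.
under eq_Rintegral do rewrite ImM.
by rewrite RintegralD ?RintegralZl//; apply: ci => //; exact: cZ.
Qed.

Lemma cint_derive a b u (U : R -> C) : a <= b -> ccont u ->
  (forall x, is_cderive U x (u x)) -> cint a b u = U b - U a.
Proof.
move=> ab [u1 u2] dU; rewrite /cint; apply: complex_eq => /=.
  rewrite (Rintegral_derive ab u1 (fun x => proj1 (dU x))).
  by case: (U b); case: (U a).
rewrite (Rintegral_derive ab u2 (fun x => proj2 (dU x))).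
by case: (U b); case: (U a).
Qed.

(** In the order of the complex numbers, a nonnegative value has zero imaginary part, so the
    imaginary integral vanishes as well. *)
Lemma cint_ge0 a b u : (forall x, a <= x <= b -> 0 <= u x) -> 0 <= cint a b u.
Proof.
move=> u0; rewrite /cint lecE/=; apply/andP; split.
  apply/eqP; under eq_Rintegral => x.
    rewrite inE/= in_itv/= => /u0; rewrite lecE/= => /andP[/eqP -> _].
    over.
  by rewrite Rintegral_cst// mul0r.
apply: Rintegral_ge0 => x/=; rewrite in_itv/= => /u0.
by rewrite lecE => /andP[].
Qed.

Lemma cint_ge0_eq0 a b u : ccont u -> (forall x, a <= x <= b -> 0 <= u x) ->
  cint a b u = 0 -> forall x, a < x < b -> u x = 0.
Proof.
move=> [u1 u2] u0 I0 x axb.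
have /u0 : a <= x <= b by case/andP: axb => /ltW -> /ltW ->.
rewrite lecE/= => /andP[/eqP h _]; apply: complex_eq => //.
apply: (continuous_ge0_Rintegral_eq0 u1 (a := a) (b := b)) => //.
  by move=> y /u0; rewrite lecE => /andP[].
by have := congr1 (@complex.Re R) I0.
Qed.

End ComplexIntegrals.

(** * Iterated integrals *)

Section TripleIntegrals.
Variable R : realType.
Local Notation C := R[i].
Implicit Types (H K : R -> R -> R -> C).

(** Finite sums of products of continuous one-variable functions. All integrands on the cycle are of
    this kind, and the class is stable under products and partial integration, so iterated integrals
    can be handled by one-variable facts alone. *)
Inductive sep : (R -> R -> R -> C) -> Prop :=
| sep_prod A B D : ccont A -> ccont B -> ccont D ->
    sep (fun al th ph => A al * B th * D ph)
| sep_add H K : sep H -> sep K ->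
    sep (fun al th ph => H al th ph + K al th ph).

Definition Tint H : C :=
  cint (- pi) pi (fun al => cint 0 pi (fun th => cint (- pi) pi (H al th))).

Lemma sep_cst (c : C) : sep (fun _ _ _ => c).
Proof.
have -> : (fun _ _ _ : R => c) = (fun al th ph => c * 1 * 1).
  by apply/funext => ?; apply/funext => ?; apply/funext => ?; rewrite !mulr1.
by apply: (sep_prod (A := fun=> c) (B := fun=> 1) (D := fun=> 1));
  exact: ccont_cst.
Qed.

Lemma sep_fst (A : R -> C) : ccont A -> sep (fun al _ _ => A al).
Proof.
move=> cA; have -> : (fun al _ _ : R => A al) = (fun al th ph => A al * 1 * 1).
  by apply/funext => ?; apply/funext => ?; apply/funext => ?; rewrite !mulr1.
by apply: (sep_prod (B := fun=> 1) (D := fun=> 1)) => //; exact: ccont_cst.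
Qed.

Lemma sep_snd (B : R -> C) : ccont B -> sep (fun _ th _ => B th).
Proof.
move=> cA; have -> : (fun _ th _ : R => B th) = (fun al th ph => 1 * B th * 1).
  by apply/funext => ?; apply/funext => ?; apply/funext => ?; rewrite mulr1 mul1r.
by apply: (sep_prod (A := fun=> 1) (D := fun=> 1)) => //; exact: ccont_cst.
Qed.

Lemma sep_thd (D : R -> C) : ccont D -> sep (fun _ _ ph => D ph).
Proof.
move=> cA; have -> : (fun _ _ ph : R => D ph) = (fun al th ph => 1 * 1 * D ph).
  by apply/funext => ?; apply/funext => ?; apply/funext => ?; rewrite !mul1r.
by apply: (sep_prod (A := fun=> 1) (B := fun=> 1)) => //; exact: ccont_cst.
Qed.

Lemma sep_mul H K : sep H -> sep K ->
  sep (fun al th ph => H al th ph * K al th ph).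
Proof.
move=> sH; elim: sH K => [A B D cA cB cD K sK|H1 H2 _ ih1 _ ih2 K sK].
  elim: sK => [A' B' D' cA' cB' cD'|K1 K2 _ ih1 _ ih2].
    have -> : (fun al th ph => A al * B th * D ph * (A' al * B' th * D' ph)) =
        (fun al th ph => (A al * A' al) * (B th * B' th) * (D ph * D' ph)).
      by apply/funext => ?; apply/funext => ?; apply/funext => ?; ring.
    by apply: (sep_prod (A := fun al => A al * A' al) (B := fun th => B th * B' th)
      (D := fun ph => D ph * D' ph)); exact: ccontM.
  under eq_fun do under eq_fun do under eq_fun do rewrite mulrDr.
  exact: sep_add.
under eq_fun do under eq_fun do under eq_fun do rewrite mulrDl.
by apply: sep_add; [exact: ih1|exact: ih2].
Qed.

Lemma sep_ccont1 H th ph : sep H -> ccont (fun al => H al th ph).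
Proof.
elim=> [A B D cA cB cD|H1 H2 _ ih1 _ ih2]; last exact: ccontD.
by do 2?[apply: ccontM] => //; exact: ccont_cst.
Qed.

Lemma sep_ccont2 H al ph : sep H -> ccont (fun th => H al th ph).
Proof.
elim=> [A B D cA cB cD|H1 H2 _ ih1 _ ih2]; last exact: ccontD.
by do 2?[apply: ccontM] => //; exact: ccont_cst.
Qed.

Lemma sep_ccont3 H al th : sep H -> ccont (H al th).
Proof.
elim=> [A B D cA cB cD|H1 H2 _ ih1 _ ih2]; last exact: ccontD.
by apply: (@ccontM _ (fun=> _)) => //; exact: ccont_cst.
Qed.

(** Supplies the continuity of the inner integral in the remaining variables, as linearity and
    positivity of the outer integrals require. The integrated variable is kept as a dummy
    argument. *)
Lemma sep_cint3 H a b : sep H -> sep (fun al th _ => cint a b (H al th)).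
Proof.
elim=> [A B D cA cB cD|H1 H2 s1 ih1 s2 ih2].
  under eq_fun do under eq_fun do rewrite cintZ//.
  by apply: (sep_prod (D := fun=> cint a b D)) => //; exact: ccont_cst.
under eq_fun do under eq_fun do
    rewrite (cintD _ _ (sep_ccont3 _ _ s1) (sep_ccont3 _ _ s2)).
exact: sep_add.
Qed.

Lemma sep_cint2 H a b : sep H ->
  sep (fun al _ ph => cint a b (fun th => H al th ph)).
Proof.
elim=> [A B D cA cB cD|H1 H2 s1 ih1 s2 ih2].
  have -> : (fun al (_ : R) ph => cint a b (fun th => A al * B th * D ph)) =
      (fun al th ph => A al * cint a b B * D ph).
    apply/funext => al; apply/funext => _; apply/funext => ph.
    under eq_fun do rewrite mulrAC.
    by rewrite cintZ// mulrAC.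
  by apply: (sep_prod (B := fun=> cint a b B)) => //; exact: ccont_cst.
under eq_fun do under eq_fun do under eq_fun do
    rewrite (cintD _ _ (sep_ccont2 _ _ s1) (sep_ccont2 _ _ s2)).
exact: sep_add.
Qed.

Lemma TintD H K : sep H -> sep K ->
  Tint (fun al th ph => H al th ph + K al th ph) = Tint H + Tint K.
Proof.
move=> sH sK; rewrite /Tint.
under eq_fun do under eq_fun do rewrite (cintD _ _ (sep_ccont3 _ _ sH) (sep_ccont3 _ _ sK)).
have tH := sep_cint3 (- pi) pi sH; have tK := sep_cint3 (- pi) pi sK.
(* The zeros fill the arguments on which the partial integrals no longer depend. *)
under eq_fun do rewrite (cintD _ _ (sep_ccont2 _ 0 tH) (sep_ccont2 _ 0 tK)).
by rewrite (cintD _ _ (sep_ccont1 0 0 (sep_cint2 0 pi tH))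
  (sep_ccont1 0 0 (sep_cint2 0 pi tK))).
Qed.

Lemma TintZ c H : sep H -> Tint (fun al th ph => c * H al th ph) = c * Tint H.
Proof.
move=> sH; rewrite /Tint.
under eq_fun do under eq_fun do rewrite (cintZ _ _ _ (sep_ccont3 _ _ sH)).
have tH := sep_cint3 (- pi) pi sH.
under eq_fun do rewrite (cintZ _ _ _ (sep_ccont2 _ 0 tH)).
by rewrite (cintZ _ _ _ (sep_ccont1 0 0 (sep_cint2 0 pi tH))).
Qed.

Lemma Tint_prod (A B D : R -> C) : ccont A -> ccont B -> ccont D ->
  Tint (fun al th ph => A al * B th * D ph) =
  cint (- pi) pi A * cint 0 pi B * cint (- pi) pi D.
Proof.
move=> cA cB cD; rewrite /Tint.
under eq_fun do under eq_fun do rewrite (cintZ _ _ _ cD) mulrAC.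
under eq_fun do rewrite (cintZ _ _ _ cB) -mulrA mulrC.
by rewrite (cintZ _ _ _ cA); ring.
Qed.

(** The one-variable statement is used once per integral sign: vanishing passes from the triple
    integral to the double one at each interior al, then to the single one at each interior th, then
    to H itself. *)
Lemma Tint_ge0_eq0 H : sep H ->
  (forall al th ph, - pi <= al <= pi -> 0 <= th <= pi -> - pi <= ph <= pi ->
    0 <= H al th ph) -> Tint H = 0 ->
  forall al th ph, - pi < al < pi -> 0 < th < pi -> - pi < ph < pi ->
    H al th ph = 0.
Proof.
move=> sH H0 I0 al th ph hal hth hph.
have w (x y z : R) : x < y < z -> x <= y <= z by case/andP => /ltW -> /ltW ->.
have tH := sep_cint3 (- pi) pi sH.
apply: (cint_ge0_eq0 (sep_ccont3 al th sH) _ _ hph).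
  by move=> x hx; apply: H0 => //; exact: w.
apply: (cint_ge0_eq0 (sep_ccont2 al 0 tH) _ _ hth).
  by move=> x hx; apply: cint_ge0 => y hy; apply: H0 => //; exact: w.
apply: (cint_ge0_eq0 (sep_ccont1 0 0 (sep_cint2 0 pi tH)) _ I0 hal).
by move=> x hx; apply: cint_ge0 => y hy; apply: cint_ge0 => z hz; exact: H0.
Qed.

End TripleIntegrals.

(** * The cycle *)

Section Parametrization.
Variable R : realType.
Local Notation C := R[i].
Local Notation M2 := 'M[C]_2.
Local Notation o0 := (ord0 : 'I_2).
Local Notation o1 := (ord_max : 'I_2).
Implicit Types (al th ph : R).

Lemma ord2P (i : 'I_2) : i = ord0 \/ i = ord_max.
Proof. by case: i => [[|[|//]]] h; [left|right]; apply/val_inj. Qed.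

Lemma mx2_00 (a b c d : C) : mx2 a b c d o0 o0 = a.
Proof. by rewrite mxE. Qed.
Lemma mx2_01 (a b c d : C) : mx2 a b c d o0 o1 = b.
Proof. by rewrite mxE. Qed.
Lemma mx2_10 (a b c d : C) : mx2 a b c d o1 o0 = c.
Proof. by rewrite mxE. Qed.
Lemma mx2_11 (a b c d : C) : mx2 a b c d o1 o1 = d.
Proof. by rewrite mxE. Qed.
Definition mx2E := (mx2_00, mx2_01, mx2_10, mx2_11).

Lemma mx2_eta (Z : M2) : Z = mx2 (Z o0 o0) (Z o0 o1) (Z o1 o0) (Z o1 o1).
Proof.
by apply/matrixP => i j; case: (ord2P i) => ->; case: (ord2P j) => ->;
  rewrite mx2E.
Qed.

Lemma det_mx2 (Z : M2) : \det Z = Z o0 o0 * Z o1 o1 - Z o0 o1 * Z o1 o0.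
Proof.
rewrite (expand_det_row _ o0) !big_ord_recl big_ord0 /cofactor !det_mx11 !mxE.
have -> : lift o0 ord0 = o1 by apply/val_inj.
have -> : lift o1 ord0 = o0 by apply/val_inj.
by rewrite /= expr0 expr1; ring.
Qed.

Lemma det_mx33 (A : 'M[C]_3) (i0 := ord0 : 'I_3) (i1 := lift ord0 ord0 : 'I_3)
    (i2 := ord_max : 'I_3) :
  \det A = A i0 i0 * (A i1 i1 * A i2 i2 - A i1 i2 * A i2 i1)
         - A i0 i1 * (A i1 i0 * A i2 i2 - A i1 i2 * A i2 i0)
         + A i0 i2 * (A i1 i0 * A i2 i1 - A i1 i1 * A i2 i0).
Proof.
(* Indexing by natural numbers lets the lifted indices of the cofactor expansion compute to
   numerals. *)
pose f m n := A (inord m) (inord n).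
have Af i j : A i j = f (val i) (val j) by rewrite /f !inord_val.
rewrite (expand_det_row _ i0) !big_ord_recl big_ord0 /cofactor !det_mx2 !mxE.
by rewrite !Af /= /bump /= expr0 expr1 expr2; ring.
Qed.

Lemma trmx_mx2 (a b c d : C) : (mx2 a b c d)^T = mx2 a c b d.
Proof.
by apply/matrixP => i j; case: (ord2P i) => ->; case: (ord2P j) => ->;
  rewrite !mxE.
Qed.

Lemma sym_entry (Z : M2) : Z^T = Z -> Z o1 o0 = Z o0 o1.
Proof. by move=> h; rewrite -[in LHS]h mxE. Qed.

Lemma imagine2 : ('i : C) ^+ 2 = -1. Proof. exact: sqrCi. Qed.

Lemma cexpiD (x y : R) : cexpi (x + y) = cexpi x * cexpi y.
Proof. by apply: complex_eq; rewrite ?ReM ?ImM /= ?cosD ?sinD; ring. Qed.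

Lemma cexpi0 : cexpi 0 = 1 :> C.
Proof. by apply: complex_eq; rewrite /= ?cos0 ?sin0. Qed.

Lemma cexpiVN (x : R) : cexpi x * cexpi (- x) = 1.
Proof. by rewrite -cexpiD subrr cexpi0. Qed.

Lemma cexpi_neq0 (x : R) : cexpi x != 0.
Proof.
by apply/eqP => h; have /eqP := cexpiVN x; rewrite h mul0r eq_sym oner_eq0.
Qed.

Lemma cexpiN (x : R) : cexpi (- x) = (cexpi x)^-1.
Proof. by apply: (mulfI (cexpi_neq0 x)); rewrite cexpiVN mulfV ?cexpi_neq0. Qed.

Lemma conj_cexpi (x : R) : conjc (cexpi x) = cexpi (- x).
Proof. by apply: complex_eq; rewrite /= ?cosN ?sinN. Qed.

Lemma cexpi_pi : cexpi pi = -1 :> C.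
Proof. by apply: complex_eq; rewrite /= ?cospi ?sinpi ?oppr0. Qed.

Lemma cexpi_Npi : cexpi (- pi) = -1 :> C.
Proof. by rewrite cexpiN cexpi_pi invrN invr1. Qed.

Definition csin (x : R) : C := (sin x)%:C%C.
Definition ccos (x : R) : C := (cos x)%:C%C.

Lemma csin2 (x : R) : csin x ^+ 2 = 1 - ccos x ^+ 2.
Proof. by rewrite /csin /ccos -!rmorphXn sin2cos2 rmorphB rmorph1. Qed.

Lemma csin0 : csin 0 = 0. Proof. by rewrite /csin sin0. Qed.
Lemma csinpi : csin pi = 0. Proof. by rewrite /csin sinpi. Qed.

Lemma GptE al th ph : Gpt al th ph =
  mx2 (cexpi al * (csin th * cexpi ph)) (cexpi al * ('i * ccos th))
      (cexpi al * ('i * ccos th)) (cexpi al * (csin th * cexpi (- ph))).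
Proof.
by apply/matrixP => i j; case: (ord2P i) => ->; case: (ord2P j) => ->;
  rewrite !mxE.
Qed.

Lemma det_Gpt al th ph : \det (Gpt al th ph) = cexpi al ^+ 2.
Proof.
rewrite det_mx2 GptE !mx2E.
transitivity (cexpi al ^+ 2 * (csin th ^+ 2 * (cexpi ph * cexpi (- ph))
   - 'i ^+ 2 * ccos th ^+ 2)); first by ring.
by rewrite cexpiVN imagine2 csin2; ring.
Qed.

Lemma Gpt_regular al th ph : regular_dom (Gpt al th ph).
Proof.
split; first by rewrite GptE trmx_mx2.
by rewrite det_Gpt expf_neq0// cexpi_neq0.
Qed.

Lemma is_cderive_csin (x : R) : is_cderive csin x (ccos x).
Proof. exact: is_cderive_sin. Qed.
Lemma is_cderive_ccos (x : R) : is_cderive ccos x (- csin x).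
Proof. by have := is_cderive_cos x; rewrite rmorphN. Qed.
Lemma is_cderive_cexpiN (x : R) :
  is_cderive (fun x => cexpi (- x)) x (- 'i * cexpi (- x)).
Proof.
have -> : - 'i * cexpi (- x) = (- sin x +i* - cos x)%C :> C.
  rewrite -complexiE; apply: complex_eq; rewrite ?ReM ?ImM /= cosN sinN; ring.
split => /=.
  by under eq_fun do rewrite cosN; exact: is_derive_cos.
by under eq_fun do rewrite sinN; exact: is_deriveN.
Qed.
Lemma is_cderive_cexpi' (x : R) : is_cderive (@cexpi R) x ('i * cexpi x).
Proof. by rewrite -complexiE; exact: is_cderive_cexpi. Qed.

Lemma ccont_cexpi : ccont (@cexpi R).
Proof. exact: is_cderive_cont is_cderive_cexpi'. Qed.
Lemma ccont_cexpiN : ccont (fun x : R => cexpi (- x)).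
Proof. exact: is_cderive_cont is_cderive_cexpiN. Qed.
Lemma ccont_csin : ccont csin.
Proof. exact: is_cderive_cont is_cderive_csin. Qed.
Lemma ccont_ccos : ccont ccos.
Proof. exact: is_cderive_cont is_cderive_ccos. Qed.

Lemma mxderive_mx2 (a b c d : R -> C) (x : R) (a' b' c' d' : C) :
  is_cderive a x a' -> is_cderive b x b' -> is_cderive c x c' ->
  is_cderive d x d' ->
  mxderive (fun y => mx2 (a y) (b y) (c y) (d y)) x = mx2 a' b' c' d'.
Proof.
move=> ha hb hc hd; apply/matrixP => i j.
by case: (ord2P i) => ->; case: (ord2P j) => ->; rewrite /mxderive mxE;
  rewrite ?mx2E; under [X in cderive X]eq_fun do rewrite !mx2E; exact: is_cderive_val.
Qed.

Lemma dZ3_mx2 (a1 b1 c1 d1 a2 b2 c2 d2 a3 b3 c3 d3 : C) :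
  dZ3 (mx2 a1 b1 c1 d1) (mx2 a2 b2 c2 d2) (mx2 a3 b3 c3 d3) =
  - 2^-1 * (b1 * (a2 * d3 - d2 * a3) - b2 * (a1 * d3 - d1 * a3)
          + b3 * (a1 * d2 - d1 * a2)).
Proof.
rewrite /dZ3 det_mx33 !mxE /=.
have i2 := imagine2.
transitivity ('i ^+ 2 * 2^-1 * (b1 * (a2 * d3 - d2 * a3) - b2 * (a1 * d3 - d1 * a3)
          + b3 * (a1 * d2 - d1 * a2))); first by field.
by rewrite i2; ring.
Qed.

Lemma jacE al th ph : jac al th ph = - 'i * cexpi al ^+ 3 * csin th.
Proof.
rewrite /jac.
under [X in mxderive X al]eq_fun do rewrite GptE.
under [X in mxderive X th]eq_fun do rewrite GptE.
under [X in mxderive X ph]eq_fun do rewrite GptE.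
have dM := is_cderiveM; have dc := @is_cderive_cst R.
have de := is_cderive_cexpi'; have ds := is_cderive_csin.
have dk := is_cderive_ccos; have dN := is_cderive_cexpiN.
rewrite (mxderive_mx2 (dM _ _ _ _ _ _ (de _) (dc _ _)) (dM _ _ _ _ _ _ (de _) (dc _ _))
  (dM _ _ _ _ _ _ (de _) (dc _ _)) (dM _ _ _ _ _ _ (de _) (dc _ _))).
rewrite (mxderive_mx2
  (dM _ _ _ _ _ _ (dc _ _) (dM _ _ _ _ _ _ (ds _) (dc _ _)))
  (dM _ _ _ _ _ _ (dc _ _) (dM _ _ _ _ _ _ (dc _ _) (dk _)))
  (dM _ _ _ _ _ _ (dc _ _) (dM _ _ _ _ _ _ (dc _ _) (dk _)))
  (dM _ _ _ _ _ _ (dc _ _) (dM _ _ _ _ _ _ (ds _) (dc _ _)))).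
rewrite (mxderive_mx2
  (dM _ _ _ _ _ _ (dc _ _) (dM _ _ _ _ _ _ (dc _ _) (de _)))
  (dM _ _ _ _ _ _ (dc _ _) (dc _ _))
  (dM _ _ _ _ _ _ (dc _ _) (dc _ _))
  (dM _ _ _ _ _ _ (dc _ _) (dM _ _ _ _ _ _ (dc _ _) (dN _)))).
rewrite dZ3_mx2.
have cs : ccos th ^+ 2 = 1 - csin th ^+ 2 by rewrite csin2; ring.
have i3 : ('i : C) ^+ 3 = - 'i by rewrite exprS imagine2 mulrN1.
move: (cexpiVN ph) cs i3.
move: (cexpi al) (cexpi ph) (cexpi (- ph)) (csin th) (ccos th) ('i : C).
move=> z w v s k j wv kk j3.
(* Valid for independent variables; what remains is e^(i ph) e^(- i ph) = 1, sin^2 + cos^2 = 1 and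
   i^3 = - i. *)
transitivity (j ^+ 3 * z ^+ 3 * s * (w * v) * (s ^+ 2 + k ^+ 2)); first by field.
by rewrite wv kk j3; ring.
Qed.

End Parametrization.

(** * The pairing as a linear form on P *)

Section PairingForm.
Variable R : realType.
Local Notation C := R[i].
Local Notation M2 := 'M[C]_2.
Local Notation o0 := (ord0 : 'I_2).
Local Notation o1 := (ord_max : 'I_2).
Implicit Types (f h : M2 -> C) (F g : M2 -> M2).

Lemma mulmx2E (A B : M2) i j : (A *m B) i j = A i o0 * B o0 j + A i o1 * B o1 j.
Proof.
rewrite mxE !big_ord_recl big_ord0 addr0.
by have -> : lift ord0 ord0 = o1 by apply/val_inj.
Qed.

Lemma mxtrace2E (A : M2) : \tr A = A o0 o0 + A o1 o1.
Proof.
rewrite /mxtrace !big_ord_recl big_ord0 addr0.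
by have -> : lift ord0 ord0 = o1 by apply/val_inj.
Qed.

Lemma inPZ c f : inP f -> inP (fun Z => c * f Z).
Proof. by move=> hf; apply: inP_mul => //; exact: inP_const. Qed.

Lemma inPN f : inP f -> inP (fun Z => - f Z).
Proof. by move=> /(inPZ (-1)); under eq_fun do rewrite mulN1r. Qed.

Lemma inPX f n : inP f -> inP (fun Z => f Z ^+ n).
Proof.
move=> hf; elim: n => [|n ih].
  by under eq_fun do rewrite expr0; exact: inP_const.
by under eq_fun do rewrite exprS; exact: inP_mul.
Qed.

Lemma inW_mul F g : inW' F -> inW' g -> inW' (fun Z => F Z *m g Z).
Proof.
move=> hF hg i j; under eq_fun do rewrite mulmx2E.
by apply: inP_add; apply: inP_mul; [exact: hF|exact: hg|exact: hF|exact: hg].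
Qed.

Lemma inW_tr F : inW' F -> inP (fun Z => \tr (F Z)).
Proof.
by move=> hF; under eq_fun do rewrite mxtrace2E; apply: inP_add; exact: hF.
Qed.

Lemma inW_add F g : inW' F -> inW' g -> inW' (fun Z => F Z + g Z).
Proof.
by move=> hF hg i j; under eq_fun do rewrite mxE; apply: inP_add;
  [exact: hF|exact: hg].
Qed.

Lemma inW_opp F : inW' F -> inW' (fun Z => - F Z).
Proof. by move=> hF i j; under eq_fun do rewrite mxE; exact/inPN/hF. Qed.

Lemma inW_scale f F : inP f -> inW' F -> inW' (fun Z => f Z *: F Z).
Proof. by move=> hf hF i j; under eq_fun do rewrite mxE; exact: inP_mul. Qed.

Lemma inW_cst (A : M2) : inW' (fun=> A).
Proof. by move=> i j; exact: inP_const. Qed.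

Lemma inW_id : inW' (fun Z : M2 => Z).
Proof. by move=> i j; exact: inP_entry. Qed.

Lemma inP_sep f : inP f -> sep (fun al th ph => f (Gpt al th ph)).
Proof.
elim=> [c|i j||f1 f2 _ h1 _ h2|f1 f2 _ h1 _ h2|f1 f2 e _ h].
- exact: sep_cst.
- have sz : sep (fun al _ _ => @cexpi R al) := sep_fst (@ccont_cexpi R).
  have ss : sep (fun _ th _ => @csin R th) := sep_snd (@ccont_csin R).
  have sc : sep (fun _ th _ => @ccos R th) := sep_snd (@ccont_ccos R).
  have sw : sep (fun _ _ ph => @cexpi R ph) := sep_thd (@ccont_cexpi R).
  have sv : sep (fun _ _ ph => @cexpi R (- ph)) := sep_thd (@ccont_cexpiN R).
  have si := sep_cst ('i : C).
  case: (ord2P i) => ->; case: (ord2P j) => ->;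
    (under eq_fun do under eq_fun do under eq_fun do rewrite GptE mx2E).
  + exact: sep_mul sz (sep_mul ss sw).
  + exact: sep_mul sz (sep_mul si sc).
  + exact: sep_mul sz (sep_mul si sc).
  + exact: sep_mul sz (sep_mul ss sv).
- under eq_fun do under eq_fun do under eq_fun do
    rewrite det_Gpt expr2 invfM -cexpiN.
  by apply: sep_fst; apply: ccontM; exact: ccont_cexpiN.
- exact: sep_add.
- exact: sep_mul.
- have <- // : (fun al th ph => f1 (Gpt al th ph)) = (fun al th ph => f2 (Gpt al th ph)).
  apply/funext => al; apply/funext => th; apply/funext => ph.
  by apply: e; exact: Gpt_regular.
Qed.

(** Up to the constant - i, the integral of N^(1/2) f dZ^3: three of the factors zeta come from dZ^3
    and the fourth from N^(1/2). The constant - i cancels the factor i in front of the pairing. *)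
Definition Lint f : C :=
  Tint (fun al th ph => cexpi al ^+ 4 * csin th * f (Gpt al th ph)).

Lemma sep_weight : sep (fun al th _ : R => cexpi al ^+ 4 * csin th : C).
Proof.
apply: sep_mul; last exact: sep_snd (@ccont_csin R).
apply: sep_fst; apply: is_cderive_cont => x.
exact: is_cderiveX (is_cderive_cexpi' x).
Qed.

Lemma inP_sep_weight f : inP f ->
  sep (fun al th ph => cexpi al ^+ 4 * csin th * f (Gpt al th ph)).
Proof. by move=> /inP_sep; apply: sep_mul; exact: sep_weight. Qed.

Lemma LintD f h : inP f -> inP h -> Lint (fun Z => f Z + h Z) = Lint f + Lint h.
Proof.
move=> /inP_sep_weight hf /inP_sep_weight hh.
rewrite /Lint -(TintD hf hh); congr Tint.
by apply/funext => al; apply/funext => th; apply/funext => ph; rewrite mulrDr.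
Qed.

Lemma LintZ c f : inP f -> Lint (fun Z => c * f Z) = c * Lint f.
Proof.
move=> /inP_sep_weight hf; rewrite /Lint -(TintZ c hf); congr Tint.
by apply/funext => al; apply/funext => th; apply/funext => ph; rewrite mulrCA.
Qed.

Lemma eq_Lint f h : (forall Z, regular_dom Z -> f Z = h Z) -> Lint f = Lint h.
Proof.
move=> e; rewrite /Lint; congr Tint.
apply/funext => al; apply/funext => th; apply/funext => ph.
by rewrite e//; exact: Gpt_regular.
Qed.

Lemma pairingE F g : inW' F -> inW' g ->
  pairing F g = (8 * pi%:C%C ^+ 2)^-1 * Lint (fun Z => \tr (F Z *m g Z)).
Proof.
move=> hF hg; have hP := inW_tr (inW_mul hF hg).
have E : Gint (fun zeta Z => \tr (F Z *m (zeta *: g Z))) =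
    Tint (fun al th ph => - 'i * (cexpi al ^+ 4 * csin th *
      \tr (F (Gpt al th ph) *m g (Gpt al th ph)))).
  rewrite /Gint -/(Tint _); congr Tint.
  apply/funext => al; apply/funext => th; apply/funext => ph.
  rewrite jacE -scalemxAr mxtraceZ.
  by move: ('i : C) (cexpi al) (csin th) (\tr _) => a b c d; ring.
rewrite /pairing E (TintZ _ (inP_sep_weight hP)).
have e : ('i : C) * - 'i = 1 by rewrite mulrN -expr2 sqrCi opprK.
rewrite -[Tint _]/(Lint (fun Z => \tr (F Z *m g Z))).
by move: (Lint _) (8 * _) => x y; rewrite mulrA [_ / y * _]mulrAC e mul1r.
Qed.

Lemma inP_conj f : inP f -> exists2 h, inP h &
  forall al th ph, h (Gpt al th ph) = conjc (f (Gpt al th ph)).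
Proof.
elim=> [c|i j||f1 f2 _ [h1 p1 e1] _ [h2 p2 e2]|f1 f2 _ [h1 p1 e1] _ [h2 p2 e2]
  |f1 f2 e _ [h p eh]].
- by exists (fun=> conjc c) => //; exact: inP_const.
- have ci : conjc ('i : C) = - 'i.
    by rewrite -complexiE; apply: complex_eq => /=; rewrite ?oppr0.
  have cs (x : R) : conjc (csin x) = csin x by exact: conjc_real.
  have ck (x : R) : conjc (ccos x) = ccos x by exact: conjc_real.
  have cM (x y : C) : conjc (x * y) = conjc x * conjc y by exact: rmorphM.
  (* On the cycle the conjugate of an entry is the corresponding cofactor divided by N; here e is
     the sign of the cofactor and (a, b) the place of the entry in it. *)
  have key (e : C) (a b : 'I_2) :
     (forall al th ph, e * Gpt al th ph a b =
        cexpi al ^+ 2 * conjc (Gpt al th ph i j)) ->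
     exists2 h : M2 -> C, inP h &
      forall al th ph, h (Gpt al th ph) = conjc (Gpt al th ph i j).
    move=> h; exists (fun Z => (\det Z)^-1 * (e * Z a b)).
      by apply: inP_mul; [exact: inP_invN|exact/inPZ/inP_entry].
    move=> al th ph; rewrite h det_Gpt mulKf// expf_neq0//; exact: cexpi_neq0.
  have zz (x : R) : cexpi x ^+ 2 * cexpi (- x) = cexpi x.
    by rewrite expr2 -mulrA cexpiVN mulr1.
  case: (ord2P i) key => ->; case: (ord2P j) => -> key.
  + apply: (key 1 o1 o1) => al th ph; rewrite GptE !mx2E !cM !conj_cexpi cs.
    by rewrite [RHS]mulrA zz mul1r.
  + apply: (key (-1) o0 o1) => al th ph; rewrite GptE !mx2E !cM conj_cexpi ci ck.
    by rewrite [RHS]mulrA zz; ring.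
  + apply: (key (-1) o0 o1) => al th ph; rewrite GptE !mx2E !cM conj_cexpi ci ck.
    by rewrite [RHS]mulrA zz; ring.
  + apply: (key 1 o0 o0) => al th ph; rewrite GptE !mx2E !cM !conj_cexpi cs opprK.
    by rewrite [RHS]mulrA zz mul1r.
- exists (fun Z => \det Z).
    under eq_fun do rewrite det_mx2.
    apply: inP_add; first by apply: inP_mul; exact: inP_entry.
    by apply/inPN/inP_mul; exact: inP_entry.
  have cM (x y : C) : conjc (x * y) = conjc x * conjc y by exact: rmorphM.
  by move=> al th ph; rewrite det_Gpt conjc_inv !expr2 cM conj_cexpi cexpiN -invfM invrK.
- by exists (fun Z => h1 Z + h2 Z); [exact: inP_add|move=> *; rewrite e1 e2 rmorphD].
- by exists (fun Z => h1 Z * h2 Z); [exact: inP_mul|move=> *; rewrite e1 e2 rmorphM].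
- by exists h => // *; rewrite eh e//; exact: Gpt_regular.
Qed.

Lemma mul_conjc_ge0 (x : C) : 0 <= x * conjc x.
Proof.
case: x => a b; rewrite lecE /=; apply/andP; split; first by apply/eqP; ring.
by rewrite mulrN opprK addr_ge0// -expr2 sqr_ge0.
Qed.

(** Testing against N^-2 times the conjugate of f makes the integrand sin th |f|^2, which is
    nonnegative. Only the open ranges of the parameters are reached: sin th must be nonzero there to
    give f = 0. *)
Lemma Lint_eq0_Gpt f : inP f -> (forall h, inP h -> Lint (fun Z => f Z * h Z) = 0) ->
  forall al th ph, - pi < al < pi -> 0 < th < pi -> - pi < ph < pi ->
  f (Gpt al th ph) = 0.
Proof.
move=> hf f0 al th ph hal hth hph.
have [h hh eh] := inP_conj hf.
pose k Z := h Z * ((\det Z)^-1) ^+ 2.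
have hk : inP k by apply: inP_mul => //; apply: inPX; exact: inP_invN.
have e al' th' ph' : cexpi al' ^+ 4 * csin th' * (f (Gpt al' th' ph') * k (Gpt al' th' ph'))
    = csin th' * (f (Gpt al' th' ph') * conjc (f (Gpt al' th' ph'))).
  rewrite /k det_Gpt eh; move: (f _) (conjc _) (cexpi al') (cexpi_neq0 al').
  by move=> x y z z0; field.
have := Tint_ge0_eq0 (inP_sep_weight (inP_mul hf hk)) _ (f0 _ hk) hal hth hph.
rewrite e => /(_ _)/eqP; rewrite !mulf_eq0 conjc_eq0 orbb => h0.
have /orP[|/eqP//] : (csin th == 0 :> C) || (f (Gpt al th ph) == 0).
  apply: h0 => a t p ha /andP[t0 tpi] hp; rewrite e mulr_ge0//; last exact: mul_conjc_ge0.
  by rewrite /csin lecE/= eqxx sin_ge0_pi// t0.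
rewrite /csin => /eqP/(congr1 (@complex.Re R))/= /eqP; rewrite gt_eqF//.
exact: sin_gt0_pi.
Qed.

End PairingForm.

(** * Non-degeneracy *)

Section Density.
Variable R : realType.
Local Notation C := R[i].
Local Notation M2 := 'M[C]_2.
Local Notation o0 := (ord0 : 'I_2).
Local Notation o1 := (ord_max : 'I_2).
Implicit Types (f h : M2 -> C).

Lemma poly_eq0_seq (p : {poly C}) (u : nat -> C) : injective u ->
  (forall n, p.[u n] = 0) -> p = 0.
Proof.
move=> iu hp; apply/eqP; apply: contraT => p0.
have := @max_poly_roots _ p (map u (iota 0 (size p))) p0.
rewrite size_map size_iota ltnn (map_inj_uniq iu) iota_uniq => /(_ _ isT).
apply; apply/allP => x /mapP[n _ ->]; apply/eqP; exact: hp.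
Qed.

Definition line_det (U V : M2) : {poly C} :=
  ((U o0 o0)%:P + V o0 o0 *: 'X) * ((U o1 o1)%:P + V o1 o1 *: 'X) -
  ((U o0 o1)%:P + V o0 o1 *: 'X) * ((U o1 o0)%:P + V o1 o0 *: 'X).

Lemma line_detE (U V : M2) x : (line_det U V).[x] = \det (U + x *: V).
Proof. by rewrite det_mx2 !mxE /line_det !hornerE; ring. Qed.

(** By induction on the construction of f, the exponents of the determinant adding up in sums and
    products. Symmetry of U and V keeps the line among the symmetric matrices, where [inP_ext] may
    exchange representatives. *)
Lemma inP_line f (U V : M2) : U^T = U -> V^T = V -> inP f ->
  exists q : {poly C}, exists k, forall x, \det (U + x *: V) != 0 ->
    f (U + x *: V) * \det (U + x *: V) ^+ k = q.[x].
Proof.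
move=> sU sV; elim=> [c|i j||f1 f2 _ [q1 [k1 h1]] _ [q2 [k2 h2]]
  |f1 f2 _ [q1 [k1 h1]] _ [q2 [k2 h2]]|f1 f2 e _ [q [k h]]].
- by exists c%:P, 0%N => x _; rewrite hornerC mulr1.
- by exists ((U i j)%:P + V i j *: 'X), 0%N => x _; rewrite !mxE !hornerE; ring.
- by exists 1, 1%N => x d0; rewrite hornerC expr1 mulVf.
- exists (q1 * line_det U V ^+ k2 + q2 * line_det U V ^+ k1), (k1 + k2)%N => x d0.
  by rewrite hornerD !hornerM !horner_exp !line_detE -h1// -h2// exprD; ring.
- exists (q1 * q2), (k1 + k2)%N => x d0.
  by rewrite hornerM -h1// -h2// exprD; ring.
- exists q, k => x d0; rewrite -e ?h//; split => //.
  by rewrite linearD linearZ/= sU sV.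
Qed.

Lemma inP_line_eq0 f (U V : M2) (u : nat -> C) : U^T = U -> V^T = V -> inP f ->
  injective u ->
  (forall n, \det (U + u n *: V) != 0 -> f (U + u n *: V) = 0) ->
  forall x, \det (U + x *: V) != 0 -> f (U + x *: V) = 0.
Proof.
move=> sU sV hf iu h0 x dx; have [q [k hq]] := inP_line sU sV hf.
(* Multiplying by the determinant takes care of the sample points where the line meets a singular
   matrix: nothing is known about f there, but the product vanishes anyway. *)
have : q * line_det U V = 0.
  apply: (poly_eq0_seq iu) => n; rewrite hornerM line_detE.
  have [->|d0] := eqVneq (\det (U + u n *: V)) 0; first by rewrite mulr0.
  by rewrite -hq// h0// !mul0r.
move=> /(congr1 (fun p => p.[x])); rewrite horner0 hornerM line_detE -hq//.
by move=> /eqP; rewrite -mulrA -exprSr mulf_eq0 expf_eq0/= (negPf dx) orbF => /eqP.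
Qed.

(** The angle is acos a or its opposite, according to the sign of b. Excluding a = -1 keeps it off
    the ends of the open range; the last clause will place the polar angle th in (0, pi). *)
Lemma polar_angle (a b : R) : a ^+ 2 + b ^+ 2 = 1 -> -1 < a ->
  exists phi, [/\ - pi < phi < pi, cos phi = a, sin phi = b & 0 < b -> 0 < phi].
Proof.
move=> ab a1.
have a2 : a <= 1 by have := sqr_ge0 b; nra.
have ha : -1 <= a <= 1 by rewrite a2 (ltW a1).
have hi : a \in `[(-1), 1] by rewrite in_itv.
have p0 : 0 < pi :> R := pi_gt0 R.
have h1 : acos a < pi by apply: acos_ltpi; rewrite a1.
have h2 : 0 <= acos a := acos_ge0 ha.
have hs : sin (acos a) = `|b|.
  by rewrite sin_acos// -ab addrAC subrr add0r sqrtr_sqr.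
have [b0|b0] := leP 0 b.
  exists (acos a); rewrite acosK// hs ger0_norm//; split => //.
    by rewrite h1 andbT (lt_le_trans _ h2)// oppr_lt0.
  move=> b1; rewrite acos_gt0// (ltW a1)/= lt_neqAle a2 andbT.
  by apply/eqP => a1'; move: ab; rewrite a1'; nra.
exists (- acos a); rewrite cosN sinN acosK// hs ltr0_norm// opprK; split => //.
  by rewrite ltrN2 h1/= (le_lt_trans _ p0)// oppr_le0.
by rewrite ltNge (ltW b0).
Qed.

(* [x], [y], [t] are the coordinates z^0, - z^3, - z^1. *)
Definition Zm (x y t : C) : M2 := mx2 (x + 'i * y) ('i * t) ('i * t) (x - 'i * y).

Lemma det_Zm x y t : \det (Zm x y t) = x ^+ 2 + y ^+ 2 + t ^+ 2.
Proof.
rewrite det_mx2 !mx2E.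
transitivity (x ^+ 2 - 'i ^+ 2 * y ^+ 2 - 'i ^+ 2 * t ^+ 2); first by ring.
by rewrite sqrCi; ring.
Qed.

Lemma sym_Zm x y t : (Zm x y t)^T = Zm x y t.
Proof. by rewrite trmx_mx2. Qed.

Lemma Zm_line x y t x' y' t' c :
  Zm x y t + c *: Zm x' y' t' = Zm (x + c * x') (y + c * y') (t + c * t').
Proof.
by apply/matrixP => i j; case: (ord2P i) => ->; case: (ord2P j) => ->;
  rewrite !mxE/=; ring.
Qed.

Lemma Zm_surj (Z : M2) : Z^T = Z -> exists x y t, Z = Zm x y t.
Proof.
move=> sZ; exists ((Z o0 o0 + Z o1 o1) / 2), (- 'i * ((Z o0 o0 - Z o1 o1) / 2)),
  (- 'i * Z o0 o1).
have e : 'i * - 'i = 1 :> C by rewrite mulrN -expr2 sqrCi opprK.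
rewrite [LHS]mx2_eta (sym_entry sZ) /Zm !mulrA e !mul1r.
by congr mx2; field.
Qed.

Lemma Gpt_Zm al th ph : Gpt al th ph =
  cexpi al *: Zm (csin th * ccos ph) (csin th * csin ph) (ccos th).
Proof.
have e (x : R) : cexpi x = ccos x + 'i * csin x.
  by rewrite -complexiE; apply: complex_eq; rewrite ?ReD ?ImD ?ReM ?ImM /=; ring.
have [cN sN] : ccos (- ph) = ccos ph /\ csin (- ph) = - csin ph.
  by rewrite /ccos /csin cosN sinN rmorphN.
rewrite GptE !(e ph) !(e (- ph)) cN sN /Zm.
by apply/matrixP => i j; case: (ord2P i) => ->; case: (ord2P j) => ->;
  rewrite !mxE/=; ring.
Qed.

Lemma inP_Gpt_eq0 f : inP f ->
  (forall al th ph, - pi < al < pi -> 0 < th < pi -> - pi < ph < pi ->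
    f (Gpt al th ph) = 0) ->
  forall Z, regular_dom Z -> f Z = 0.
Proof.
move=> hf f0.
(* From the unit circle to C^*: for X fixed on the sphere, f vanishes at infinitely many points of
   the line c X through the origin. *)
have s1 th ph c : 0 < th < pi -> - pi < ph < pi -> c != 0 ->
    f (c *: Zm (csin th * ccos ph) (csin th * csin ph) (ccos th)) = 0.
  move=> hth hph c0; set V := Zm _ _ _.
  have dV : \det V = 1.
    rewrite det_Zm.
    transitivity (csin th ^+ 2 * (csin ph ^+ 2 + ccos ph ^+ 2) + ccos th ^+ 2).
      by ring.
    by rewrite !csin2; ring.
  (* The angles 1 / (n + 1) lie in [0, pi), where the cosine is injective, so these points of the
     circle are distinct. *)
  pose u n : C := cexpi (n.+1%:R^-1).
  have un n : 0 <= n.+1%:R^-1 :> R /\ n.+1%:R^-1 < pi :> R.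
    split; first by rewrite invr_ge0.
    apply: (@le_lt_trans _ _ 1); last by have := pi_ge2 R; lra.
    by rewrite invf_le1// ler1n.
  have iu : injective u.
    move=> m n /(congr1 (@complex.Re R)) /= h.
    have [m0 mp] := un m; have [n0 np] := un n.
    have : m.+1%:R^-1 = n.+1%:R^-1 :> R.
      by apply: cos_inj => //; rewrite in_itv/= ?m0 ?n0 ltW.
    by move=> /invr_inj /eqP; rewrite eqr_nat => /eqP[].
  rewrite -[_ *: V]add0r.
  apply: (inP_line_eq0 (u := u) _ _ hf iu); rewrite ?trmx0 ?sym_Zm//.
    move=> n _; rewrite add0r /V -Gpt_Zm f0//.
    by have [h1 h2] := un n; rewrite h2 andbT (lt_le_trans _ h1)// oppr_lt0 pi_gt0.
  by rewrite add0r detZ dV mulr1 expf_neq0.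
(* Spherical coordinates with radius r and azimuth ph. The condition x > 0 makes p and r positive,
   and keeps ph away from pi and th away from 0 and pi. *)
have s2 (x y t : R) : 0 < x -> f (Zm x%:C%C y%:C%C t%:C%C) = 0.
  move=> x0.
  pose p := Num.sqrt (x ^+ 2 + y ^+ 2).
  have hp : p ^+ 2 = x ^+ 2 + y ^+ 2 by rewrite sqr_sqrtr// addr_ge0// sqr_ge0.
  have p0 : 0 < p by rewrite sqrtr_gt0; nra.
  pose r := Num.sqrt (p ^+ 2 + t ^+ 2).
  have hr : r ^+ 2 = p ^+ 2 + t ^+ 2 by rewrite sqr_sqrtr// addr_ge0// sqr_ge0.
  have r0 : 0 < r by rewrite sqrtr_gt0; nra.
  have [||ph [hph c1 d1 _]] := @polar_angle (x / p) (y / p).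
  - by rewrite !exprMn -mulrDl -hp exprVn mulfV// expf_neq0// gt_eqF.
  - by rewrite (@lt_trans _ _ 0)// ?divr_gt0//; lra.
  have [||th [hth c2 d2 th0]] := @polar_angle (t / r) (p / r).
  - by rewrite !exprMn -mulrDl addrC -hr exprVn mulfV// expf_neq0// gt_eqF.
  - rewrite ltr_pdivlMr//; nra.
  have hth' : 0 < th < pi by case/andP: hth => _ ->; rewrite th0// divr_gt0.
  have := s1 th ph r%:C%C hth' hph.
  have -> : r%:C%C *: Zm (csin th * ccos ph) (csin th * csin ph) (ccos th) =
     Zm x%:C%C y%:C%C t%:C%C.
    have h := Zm_line 0 0 0 (csin th * ccos ph) (csin th * csin ph) (ccos th) r%:C%C.
    have Z0 : Zm 0 0 0 = 0.
      by apply/matrixP => i j; case: (ord2P i) => ->; case: (ord2P j) => ->;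
        rewrite !mxE/= ?mulr0 ?addr0 ?subr0.
    rewrite Z0 add0r in h; rewrite h !add0r /csin /ccos c1 c2 d1 d2 -!rmorphM.
    have rn : r != 0 by rewrite gt_eqF.
    have pn : p != 0 by rewrite gt_eqF.
    by congr (Zm _%:C%C _%:C%C _%:C%C); field; rewrite ?rn ?pn.
  by apply; rewrite eq_complex/= negb_and gt_eqF.
have natC n : n%:R = (n%:R : R)%:C%C :> C by rewrite rmorph_nat.
have inat : injective (fun n => n%:R : C).
  by move=> m n /eqP; rewrite eqr_nat => /eqP.
(* The coordinates are made complex one at a time, starting with x. Its sample points are the
   integers n + 1, since vanishing is so far known for x > 0 only; for y and t all natural numbers
   serve. *)
have s3 (x : C) (y t : R) : \det (Zm x y%:C%C t%:C%C) != 0 ->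
    f (Zm x y%:C%C t%:C%C) = 0.
  have := @inP_line_eq0 f (Zm 0 y%:C%C t%:C%C) (Zm 1 0 0) (fun n => n.+1%:R)
    (sym_Zm _ _ _) (sym_Zm _ _ _) hf.
  have e c : Zm 0 y%:C%C t%:C%C + c *: Zm 1 0 0 = Zm c y%:C%C t%:C%C.
    by rewrite Zm_line; congr Zm; ring.
  move=> /(_ _ _ x); rewrite !e; apply; first by move=> m n /inat [].
  by move=> n _; rewrite e natC s2.
have s4 (x y : C) (t : R) : \det (Zm x y t%:C%C) != 0 -> f (Zm x y t%:C%C) = 0.
  have := @inP_line_eq0 f (Zm x 0 t%:C%C) (Zm 0 1 0) (fun n => n%:R)
    (sym_Zm _ _ _) (sym_Zm _ _ _) hf inat.
  have e c : Zm x 0 t%:C%C + c *: Zm 0 1 0 = Zm x c t%:C%C.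
    by rewrite Zm_line; congr Zm; ring.
  by move=> /(_ _ y); rewrite !e; apply=> n; rewrite e natC; exact: s3.
have s5 (x y t : C) : \det (Zm x y t) != 0 -> f (Zm x y t) = 0.
  have := @inP_line_eq0 f (Zm x y 0) (Zm 0 0 1) (fun n => n%:R)
    (sym_Zm _ _ _) (sym_Zm _ _ _) hf inat.
  have e c : Zm x y 0 + c *: Zm 0 0 1 = Zm x y c.
    by rewrite Zm_line; congr Zm; ring.
  by move=> /(_ _ t); rewrite !e; apply=> n; rewrite e natC; exact: s4.
by move=> Z [sZ dZ]; have [x [y [t e]]] := Zm_surj sZ; move: dZ; rewrite e; exact: s5.
Qed.

Lemma inP_nondegenerate f : inP f ->
  (forall h, inP h -> Lint (fun Z => f Z * h Z) = 0) ->
  forall Z, regular_dom Z -> f Z = 0.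
Proof. by move=> hf /(Lint_eq0_Gpt hf); exact: inP_Gpt_eq0. Qed.

Lemma pairing_nondegenerate_l (F : M2 -> M2) : inW' F ->
  (forall g, inWs g -> pairing F g = 0) ->
  forall Z, regular_dom Z -> F Z = 0.
Proof.
move=> hF F0 Z rZ; apply/matrixP => i j; rewrite [RHS]mxE.
apply: (inP_nondegenerate (hF i j)) rZ => h hh.
(* With the matrix unit at (j, i), the trace of F g is h times the single entry F i j. *)
pose g Z : M2 := h Z *: delta_mx j i.
have hg : inWs g by apply: inW_scale => //; exact: inW_cst.
have := F0 _ hg; rewrite pairingE// => /eqP; rewrite mulf_eq0 => /orP[|/eqP].
  by rewrite invr_eq0 mulf_eq0 pnatr_eq0/= expf_eq0/= eq_complex/= gt_eqF// pi_gt0.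
move=> <-; apply: eq_Lint => W _.
rewrite /g -scalemxAr mxtraceZ mulrC; congr (_ * _).
rewrite mxtrace2E !mulmx2E !mxE.
by case: (ord2P i) => ->; case: (ord2P j) => ->; rewrite /=; ring.
Qed.

Lemma Lint_trC (F g : M2 -> M2) :
  Lint (fun Z => \tr (F Z *m g Z)) = Lint (fun Z => \tr (g Z *m F Z)).
Proof. by apply: eq_Lint => Z _; exact: mxtrace_mulC. Qed.

(** The two arguments may be exchanged because elements of N^(1/2) P are represented by their
    cofactors in P: [inW'] and [inWs] are the same condition, and the trace is cyclic. Statements
    about the second argument thus follow from those about the first. *)
Lemma pairingC (F g : M2 -> M2) : inW' F -> inW' g -> pairing F g = pairing g F.
Proof. by move=> hF hg; rewrite (pairingE hF hg) (pairingE hg hF) Lint_trC. Qed.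

Lemma pairing_nondegenerate_r (g : M2 -> M2) : inWs g ->
  (forall F, inW' F -> pairing F g = 0) ->
  forall Z, regular_dom Z -> g Z = 0.
Proof.
move=> hg g0; apply: (pairing_nondegenerate_l hg) => F hF.
by rewrite (pairingC hg hF); exact: g0.
Qed.

Lemma pairing_linear_l (a : C) (F1 F2 g : M2 -> M2) :
  inW' F1 -> inW' F2 -> inWs g ->
  pairing (fun Z => a *: F1 Z + F2 Z) g = a * pairing F1 g + pairing F2 g.
Proof.
move=> h1 h2 hg.
have h := inW_add (inW_scale (inP_const a) h1) h2.
have p1 := inW_tr (inW_mul h1 hg); have p2 := inW_tr (inW_mul h2 hg).
have E : Lint (fun Z => \tr ((a *: F1 Z + F2 Z) *m g Z)) =
    a * Lint (fun Z => \tr (F1 Z *m g Z)) + Lint (fun Z => \tr (F2 Z *m g Z)).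
  apply: etrans (etrans (LintD (inPZ a p1) p2) _); last by rewrite (LintZ a p1).
  by apply: eq_Lint => Z _; rewrite mulmxDl raddfD/= -scalemxAl mxtraceZ.
rewrite (pairingE h hg) (pairingE h1 hg) (pairingE h2 hg) E.
by rewrite mulrDr mulrCA.
Qed.

Lemma pairing_linear_r (a : C) (F g1 g2 : M2 -> M2) :
  inW' F -> inWs g1 -> inWs g2 ->
  pairing F (fun Z => a *: g1 Z + g2 Z) = a * pairing F g1 + pairing F g2.
Proof.
move=> hF h1 h2; have h := inW_add (inW_scale (inP_const a) h1) h2.
by rewrite (pairingC hF h) (pairing_linear_l a h1 h2 hF) (pairingC h1 hF) (pairingC h2 hF).
Qed.

End Density.

(** * Derivatives on P *)

Lemma horner_continuous (K : numFieldType) (q : {poly K}) (x : K) :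
  {for x, continuous (horner q : K -> K)}.
Proof.
elim/poly_ind: q => [|q c ih].
  have -> : horner (0 : {poly K}) = cst 0 by apply/funext => t; rewrite horner0.
  exact: cst_continuous.
have -> : horner (q * 'X + c%:P) = (fun t : K => (q.[t] * t : K) + cst c t : K).
  by apply/funext => t; rewrite hornerMXaddC.
apply: continuousD; last exact: cst_continuous.
apply: continuousM; first exact: ih.
exact: cvg_id.
Qed.
Lemma horner_near_neq0 (K : numFieldType) (q : {poly K}) :
  q.[0] != 0 -> \forall t \near (0 : K), q.[t] != 0.
Proof. by move=> q0; apply: (cvgr_neq0 _ (@horner_continuous _ q 0)). Qed.

Section Derivatives.
Variable R : realType.
Local Notation C := R[i].
Local Notation M2 := 'M[C]_2.
Local Notation o0 := (ord0 : 'I_2).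
Local Notation o1 := (ord_max : 'I_2).
Implicit Types (f h : M2 -> C) (v Z : M2).

(** A derivative is prescribed only at regular points, the values of f' elsewhere being irrelevant
    like those of f. *)
Definition isD v f f' := forall Z, regular_dom Z ->
  is_derive Z v (f : M2 -> C^o) (f' Z : C^o).

Definition Ddet v Z : C :=
  v o0 o0 * Z o1 o1 + Z o0 o0 * v o1 o1 - (v o0 o1 * Z o1 o0 + Z o0 o1 * v o1 o0).

(** Along the line, the determinant is a polynomial in the parameter that is nonzero at 0, hence
    nonzero near 0. *)
Lemma regular_near v Z : v^T = v -> regular_dom Z ->
  \forall h \near (0 : C^o), regular_dom (h *: v + Z).
Proof.
move=> sv [sZ dZ].
have p0 : (line_det Z v).[0] != 0 by rewrite line_detE scale0r addr0.
have := @horner_near_neq0 C _ p0; apply: filterS => t; rewrite line_detE addrC => dt.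
by split => //; rewrite linearD linearZ/= sv sZ.
Qed.

(** In a symmetric direction the nearby points stay regular, so the difference quotients of f and h
    coincide near 0. This makes differentiation independent of the chosen representative. *)
Lemma isD_ext v f h f' : v^T = v -> (forall Z, regular_dom Z -> f Z = h Z) ->
  isD v f f' -> isD v h f'.
Proof.
move=> sv e hf Z rZ; have [df <-] := hf Z rZ.
have gr : \forall t \near (0 : C^o)^',
    t^-1 *: (((f : M2 -> C^o) \o shift Z) (t *: v) - f Z) =
    t^-1 *: (((h : M2 -> C^o) \o shift Z) (t *: v) - h Z).
  apply: cvg_within; have := regular_near sv rZ; apply: filterS => t rt.
  by rewrite /= (e _ rZ) e.
have gr' : \forall t \near (0 : C^o)^',
    t^-1 *: (((h : M2 -> C^o) \o shift Z) (t *: v) - h Z) =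
    t^-1 *: (((f : M2 -> C^o) \o shift Z) (t *: v) - f Z).
  by apply: filterS gr => t ->.
split.
  move: df => /cvg_ex[/= l fl]; apply/cvg_ex; exists l => /=.
  exact/(cvg_trans _ fl)/near_eq_cvg.
by rewrite /derive; congr (lim _); rewrite eqEsubset; split; apply/near_eq_cvg.
Qed.

Lemma isD_eq v f f' f'' : (forall Z, regular_dom Z -> f' Z = f'' Z) ->
  isD v f f' -> isD v f f''.
Proof. by move=> e h Z rZ; rewrite -e//; exact: h. Qed.

Lemma isD_cst v (c : C) : isD v (fun=> c) (fun=> 0).
Proof. by move=> Z _; exact: is_derive_cst. Qed.

Lemma isD_entry v i j : isD v (fun Z => Z i j) (fun=> v i j).
Proof.
move=> Z _.
have gr : \forall t \near (0 : C^o)^', t^-1 *: ((((fun Z => Z i j) : M2 -> C^o) \o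
   shift Z) (t *: v) - Z i j) = (v i j : C^o).
  have : \forall t \near (0 : C^o)^', t != 0 by exact: nbhs_dnbhs_neq.
  by apply: filterS => t t0; rewrite /= !mxE addrK /GRing.scale/= mulKf.
split; last exact: lim_near_cst.
exact: is_cvg_near_cst gr.
Qed.

Lemma isDD v f h f' h' : isD v f f' -> isD v h h' ->
  isD v (fun Z => f Z + h Z) (fun Z => f' Z + h' Z).
Proof. by move=> hf hh Z rZ; exact: is_deriveD (hf Z rZ) (hh Z rZ). Qed.

Lemma isDM v f h f' h' : isD v f f' -> isD v h h' ->
  isD v (fun Z => f Z * h Z) (fun Z => f' Z * h Z + f Z * h' Z).
Proof.
move=> hf hh Z rZ; apply: (is_derive_eq (is_deriveM (hf Z rZ) (hh Z rZ))).
by rewrite /GRing.scale/=; ring.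
Qed.

Lemma isDX v f f' n : isD v f f' ->
  isD v (fun Z => f Z ^+ n) (fun Z => n%:R * f Z ^+ n.-1 * f' Z).
Proof.
move=> hf; elim: n => [|n ih].
  under eq_fun do rewrite expr0.
  by apply: isD_eq (isD_cst _ 1) => Z _; rewrite !mul0r.
under eq_fun do rewrite exprS.
apply: isD_eq (isDM hf ih) => Z _ /=.
by case: n {ih} => [|n] /=; rewrite ?expr0 ?exprS; ring.
Qed.

Lemma isD_det v : isD v (fun Z => \det Z) (Ddet v).
Proof.
have e := @isD_entry v.
have := isDD (isDM (e o0 o0) (e o1 o1))
  (isDM (isD_cst _ (-1)) (isDM (e o0 o1) (e o1 o0))).
have -> : (fun Z : M2 => Z o0 o0 * Z o1 o1 + -1 * (Z o0 o1 * Z o1 o0)) =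
  (fun Z => \det Z) by apply/funext => Z; rewrite det_mx2; ring.
by apply: isD_eq => Z _; rewrite /Ddet; ring.
Qed.

Lemma isD_invdet v :
  isD v (fun Z => (\det Z)^-1) (fun Z => - (\det Z)^-1 ^+ 2 * Ddet v Z).
Proof.
move=> Z rZ; have [dd de] := isD_det v rZ; have [_ d0] := rZ.
split; first exact: derivableV.
by rewrite deriveV// de /GRing.scale/= exprVn.
Qed.

Lemma inP_isD v f : v^T = v -> inP f -> exists2 f', inP f' & isD v f f'.
Proof.
move=> sv; elim=> [c|i j||f1 f2 i1 [h1 p1 e1] i2 [h2 p2 e2]
  |f1 f2 i1 [h1 p1 e1] i2 [h2 p2 e2]|f1 f2 e _ [h p eh]].
- by exists (fun=> 0); [exact: inP_const|exact: isD_cst].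
- by exists (fun=> v i j); [exact: inP_const|exact: isD_entry].
- exists (fun Z => - (\det Z)^-1 ^+ 2 * Ddet v Z); last exact: isD_invdet.
  apply: inP_mul; first by apply/inPN/inPX; exact: inP_invN.
  apply: inP_add; [|apply: inPN]; apply: inP_add; apply: inP_mul;
    by [exact: inP_const|exact: inP_entry].
- by exists (fun Z => h1 Z + h2 Z); [exact: inP_add|exact: isDD].
- exists (fun Z => h1 Z * f2 Z + f1 Z * h2 Z); last exact: isDM.
  by apply: inP_add; exact: inP_mul.
- by exists h => //; exact: isD_ext eh.
Qed.

Lemma isD_derive v f f' Z : isD v f f' -> regular_dom Z ->
  'D_v (f : M2 -> C^o) Z = f' Z.
Proof. by move=> h /h[]. Qed.

Lemma inP_derive v f : v^T = v -> inP f -> inP (fun Z => 'D_v (f : M2 -> C^o) Z).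
Proof.
move=> sv /(inP_isD sv)[f' h df]; apply: inP_ext h => Z rZ.
by rewrite (isD_derive df).
Qed.

Lemma inP_isD_derive v f : v^T = v -> inP f ->
  isD v f (fun Z => 'D_v (f : M2 -> C^o) Z).
Proof.
move=> sv /(inP_isD sv)[f' h df]; apply: (isD_eq _ df) => Z rZ.
by rewrite (isD_derive df).
Qed.

End Derivatives.

(** * Integration by parts *)

Section Stokes.
Variable R : realType.
Local Notation C := R[i].
Local Notation M2 := 'M[C]_2.
Local Notation o0 := (ord0 : 'I_2).
Local Notation o1 := (ord_max : 'I_2).
Implicit Types (f h : M2 -> C) (v Z : M2) (p q n : nat).

(** Two natural exponents encode the integer frequency p - q, which may be negative; by [EintSS]
    only the difference matters. *)
Definition Eint p q : C :=
  cint (- pi) pi (fun x : R => cexpi x ^+ p * cexpi (- x) ^+ q).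
Definition Jint p q : C := cint 0 pi (fun x : R => csin x ^+ p * ccos x ^+ q).

Lemma ccontX (u : R -> C) n : ccont u -> ccont (fun x => u x ^+ n).
Proof.
move=> cu; elim: n => [|n ih].
  by under eq_fun do rewrite expr0; exact: ccont_cst.
by under eq_fun do rewrite exprS; exact: ccontM.
Qed.

Lemma ccont_cexpiX p q : ccont (fun x : R => cexpi x ^+ p * cexpi (- x) ^+ q).
Proof.
by apply: ccontM; apply: ccontX; [exact: ccont_cexpi|exact: ccont_cexpiN].
Qed.

Lemma ccont_csinX p q : ccont (fun x : R => csin x ^+ p * ccos x ^+ q).
Proof. by apply: ccontM; apply: ccontX; [exact: ccont_csin|exact: ccont_ccos]. Qed.

Lemma EintSS p q : Eint p.+1 q.+1 = Eint p q.
Proof.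
rewrite /Eint; congr cint; apply/funext => x; rewrite !exprS.
transitivity (cexpi x * cexpi (- x) * (cexpi x ^+ p * cexpi (- x) ^+ q)); first by ring.
by rewrite cexpiVN mul1r.
Qed.

(** The integrand divided by i (p - q) is its own antiderivative and is periodic: it takes the same
    value at both ends, where [cexpi] is -1. *)
Lemma Eint_neq p q : p != q -> Eint p q = 0.
Proof.
move=> pq; have c0 : 'i * (p%:R - q%:R) != 0 :> C.
  by rewrite mulf_neq0 ?neq0Ci// subr_eq0 eqr_nat.
have h (x : R) : is_cderive (fun x : R =>
    ('i * (p%:R - q%:R))^-1 * (cexpi x ^+ p * cexpi (- x) ^+ q)) x
    (cexpi x ^+ p * cexpi (- x) ^+ q).
  have := is_cderiveM (is_cderive_cst (('i * (p%:R - q%:R))^-1) x)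
    (is_cderiveM (is_cderiveX p (is_cderive_cexpi' x)) (is_cderiveX q (is_cderive_cexpiN x))).
  rewrite mul0r add0r.
  have X (y : C) n : n%:R * y ^+ n.-1 * y = n%:R * y ^+ n.
    by case: n => [|n]; [rewrite !mul0r|rewrite -mulrA -exprSr].
  move=> H; apply: (is_cderive_eq H); apply: (canLR (mulKf c0)).
  transitivity ('i * (p%:R * cexpi x ^+ p.-1 * cexpi x) * cexpi (- x) ^+ q
    - 'i * cexpi x ^+ p * (q%:R * cexpi (- x) ^+ q.-1 * cexpi (- x))); first by ring.
  by rewrite !X; ring.
rewrite /Eint (cint_derive _ (ccont_cexpiX p q) h).
  by rewrite !opprK cexpi_pi cexpi_Npi subrr.
by have := pi_ge0 R; lra.
Qed.

Lemma Jint_sum p q : Jint p.+2 q + Jint p q.+2 = Jint p q.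
Proof.
rewrite /Jint -cintD; try exact: ccont_csinX.
congr cint; apply/funext => x; rewrite !exprS.
transitivity ((csin x ^+ 2 + ccos x ^+ 2) * (csin x ^+ p * ccos x ^+ q)); first by ring.
by rewrite csin2 subrK mul1r.
Qed.

(** Integrate the derivative of sin^(p+1) cos^q; the positive power of the sine kills both boundary
    terms. At q = 0 the truncated exponent is harmless, its coefficient being zero. *)
Lemma Jint_parts p q : p.+1%:R * Jint p q.+1 = q%:R * Jint p.+2 q.-1.
Proof.
have h (x : R) := is_cderiveM (is_cderiveX p.+1 (is_cderive_csin x))
  (is_cderiveX q (is_cderive_ccos x)).
have c1 := ccont_csinX p q.+1; have c2 := ccont_csinX p.+2 q.-1.
apply/eqP; rewrite -subr_eq0 -mulNr /Jint -!cintZ// -cintD; try exact: (ccontM (ccont_cst _)).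
have e (x : R) : p.+1%:R * csin x ^+ p.+1.-1 * ccos x * ccos x ^+ q +
   csin x ^+ p.+1 * (q%:R * ccos x ^+ q.-1 * - csin x) =
   p.+1%:R * (csin x ^+ p * ccos x ^+ q.+1) + - q%:R * (csin x ^+ p.+2 * ccos x ^+ q.-1) :> C.
  by rewrite !exprS/=; ring.
have h' (x : R) : is_cderive (fun x : R => csin x ^+ p.+1 * ccos x ^+ q) x
  (p.+1%:R * (csin x ^+ p * ccos x ^+ q.+1) + - q%:R * (csin x ^+ p.+2 * ccos x ^+ q.-1)).
  by rewrite -e.
rewrite (cint_derive _ _ h') ?pi_ge0//.
  by rewrite csinpi csin0 !expr0n !mul0r subrr.
by apply: ccontD; exact: (ccontM (ccont_cst _)).
Qed.

(** Integration by parts, with cos^2 replaced by 1 - sin^2 so that the power of the cosine stays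
    fixed. [Jint_rec_cos] fixes the power of the sine instead. *)
Lemma Jint_rec_sin p q : p.+1%:R * Jint p q = (p + q).+2%:R * Jint p.+2 q.
Proof.
have := Jint_parts p q.+1; rewrite /= -(Jint_sum p q) => h.
by rewrite mulrDr h -mulrDl -natrD; congr (_%:R * _); lia.
Qed.

Lemma Jint_rec_cos p q : q%:R * Jint p q.-1 = (p + q).+1%:R * Jint p q.+1.
Proof.
have := Jint_parts p q; case: q => [|q] /= h.
  by rewrite addn0 h !mul0r.
rewrite -(Jint_sum p q) mulrDr -h -mulrDl -natrD; congr (_%:R * _); lia.
Qed.

Definition mono (a b c k : nat) Z : C :=
  Z o0 o0 ^+ a * Z o1 o1 ^+ b * Z o0 o1 ^+ c * (\det Z)^-1 ^+ k.

Lemma inP_mono a b c k : inP (mono a b c k).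
Proof.
by do ![apply: inP_mul]; apply: inPX; first [exact: inP_entry|exact: inP_invN].
Qed.

(** On the cycle a monomial is a product of one-variable functions. The weight of [Lint] accounts
    for the 4 and for the successor in the exponent of the sine, and i^c comes from z12 = i zeta cos
    th. *)
Lemma Lint_mono a b c k : Lint (mono a b c k) =
  Eint (a + b + c + 4) (k + k) * Jint (a + b).+1 c * ('i ^+ c * Eint a b).
Proof.
have e : Lint (mono a b c k) = Tint (fun al th ph =>
   (cexpi al ^+ (a + b + c + 4) * cexpi (- al) ^+ (k + k)) *
   (csin th ^+ (a + b).+1 * ccos th ^+ c) *
   ('i ^+ c * (cexpi ph ^+ a * cexpi (- ph) ^+ b))).
  rewrite /Lint; congr Tint; apply/funext => al; apply/funext => th; apply/funext => ph.
  rewrite /mono det_Gpt GptE !mx2E.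
  have -> : (cexpi al ^+ 2)^-1 ^+ k = cexpi (- al) ^+ (k + k).
    by rewrite -exprVn -cexpiN -exprM mul2n addnn.
  by rewrite !exprMn !exprD !exprS !exprD; ring.
rewrite e (Tint_prod (ccont_cexpiX _ _) (ccont_csinX _ _)
  (ccontM (ccont_cst _) (ccont_cexpiX a b))).
by rewrite (cintZ _ _ _ (ccont_cexpiX _ _)).
Qed.

(** The same functions as [inP], generated linearly by monomials instead of as an algebra; linear
    statements about P can then be proved by induction from the monomials. *)
Inductive spanP : (M2 -> C) -> Prop :=
| spanP_mono x a b c k : spanP (fun Z => x * mono a b c k Z)
| spanP_add f h : spanP f -> spanP h -> spanP (fun Z => f Z + h Z)
| spanP_ext f h : (forall Z, regular_dom Z -> f Z = h Z) -> spanP f -> spanP h.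

Lemma spanP_inP f : spanP f -> inP f.
Proof.
elim=> [x a b c k|f1 f2 _ h1 _ h2|f1 f2 e _ h].
- exact/inPZ/inP_mono.
- exact: inP_add.
- exact: inP_ext h.
Qed.

Lemma spanP_mulmono x a b c k f : spanP f ->
  spanP (fun Z => x * mono a b c k Z * f Z).
Proof.
elim=> [x' a' b' c' k'|f1 f2 _ h1 _ h2|f1 f2 e _ h].
- apply: spanP_ext (spanP_mono (x * x') (a + a') (b + b') (c + c') (k + k')).
  by move=> Z _; rewrite /mono !exprD; ring.
- by under eq_fun do rewrite mulrDr; exact: spanP_add.
- by apply: spanP_ext h => Z rZ; rewrite e.
Qed.

Lemma inP_spanP f : inP f -> spanP f.
Proof.
(* Strengthened to multiplication by f preserving the span, so that the product case of the
   induction is a composition; applying it to the constant 1 gives f back. *)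
suff H : inP f -> forall h, spanP h -> spanP (fun Z => f Z * h Z).
  move=> /H /(_ _ (spanP_mono 1 0 0 0 0)); apply: spanP_ext => Z _.
  by rewrite /mono !expr0 !mulr1.
elim=> [x|i j||f1 f2 _ h1 _ h2|f1 f2 _ h1 _ h2|f1 f2 e _ h1] h sh.
- apply: spanP_ext (spanP_mulmono x 0 0 0 0 sh) => Z _.
  by rewrite /mono !expr0 !mulr1.
- case: (ord2P i) => ->; case: (ord2P j) => ->.
  + apply: spanP_ext (spanP_mulmono 1 1 0 0 0 sh) => Z _.
    by rewrite /mono !expr0 expr1 !mulr1 !mul1r.
  + apply: spanP_ext (spanP_mulmono 1 0 0 1 0 sh) => Z _.
    by rewrite /mono !expr0 expr1 !mulr1 !mul1r.
  + apply: spanP_ext (spanP_mulmono 1 0 0 1 0 sh) => Z [sZ _].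
    by rewrite /mono !expr0 expr1 !mulr1 !mul1r (sym_entry sZ).
  + apply: spanP_ext (spanP_mulmono 1 0 1 0 0 sh) => Z _.
    by rewrite /mono !expr0 expr1 !mulr1 !mul1r.
- apply: spanP_ext (spanP_mulmono 1 0 0 0 1 sh) => Z _.
  by rewrite /mono !expr0 expr1 !mul1r.
- by under eq_fun do rewrite mulrDl; apply: spanP_add; [exact: h1|exact: h2].
- by under eq_fun do rewrite -mulrA; apply/h1/h2.
- by apply: spanP_ext (h1 _ sh) => Z rZ; rewrite e.
Qed.

(* [N^(-1/2) 'D_v (N^(1/2) f)] *)
Definition Dhalf v f Z : C :=
  'D_v (f : M2 -> C^o) Z + 2^-1 * (\det Z)^-1 * Ddet v Z * f Z.

(** The power of N contributes (1/2 - k) N^(-k-1) dN. Since N = z11 z22 - z12^2, the z12-derivative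
    of N is - 2 z12, which turns 1/2 - k into 2 k - 1 in the last term. *)
Lemma Dhalf_mono v a b c k Z : v^T = v -> regular_dom Z ->
  Dhalf v (mono a b c k) Z =
  v o0 o0 * (a%:R * mono a.-1 b c k Z + (2^-1 - k%:R) * mono a b.+1 c k.+1 Z) +
  (v o1 o1 * (b%:R * mono a b.-1 c k Z + (2^-1 - k%:R) * mono a.+1 b c k.+1 Z) +
  v o0 o1 * (c%:R * mono a b c.-1 k Z + (2 * k%:R - 1) * mono a b c.+1 k.+1 Z)).
Proof.
move=> sv rZ; have e := @isD_entry R v.
have dm := isDM (isDM (isDM (isDX a (e o0 o0)) (isDX b (e o1 o1)))
  (isDX c (e o0 o1))) (isDX k (@isD_invdet R v)).
rewrite /Dhalf (isD_derive dm rZ) /Ddet /mono.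
rewrite (sym_entry sv) (sym_entry (proj1 rZ)).
have K (x : C) : k%:R * x ^+ k.-1 * - x ^+ 2 = - k%:R * x ^+ k.+1.
  by case: k {dm} => [|k]; rewrite ?mul0r ?oppr0 ?mul0r// !exprS /=; ring.
rewrite [k%:R * _ * (_ * _)]mulrA K !exprS.
move: (\det Z)^-1 (v o0 o0) (v o1 o1) (v o0 o1) => N v0 v1 v2.
move: (Z o0 o0 ^+ a) (Z o0 o0 ^+ a.-1) (Z o1 o1 ^+ b) (Z o1 o1 ^+ b.-1)
  (Z o0 o1 ^+ c) (Z o0 o1 ^+ c.-1) => za za' zb zb' zc zc'.
move: (N ^+ k) (a%:R : C) (b%:R : C) (c%:R : C) (k%:R : C) => Nk ca cb cc ck.
move: (Z o0 o0) (Z o0 o1) (Z o1 o1) => x y z.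
by field.
Qed.

(** Both terms have the same frequencies in ph and in al, so they vanish together unless these are
    zero; in that case the identity is [Jint_rec_sin]. *)
Lemma Lint_Dhalf_mono11 a b c k :
  Lint (fun Z => a%:R * mono a.-1 b c k Z + (2^-1 - k%:R) * mono a b.+1 c k.+1 Z) = 0.
Proof.
rewrite LintD; try exact/inPZ/inP_mono.
rewrite !LintZ; try exact: inP_mono.
rewrite !Lint_mono.
(* For a = 0 the first term is absent and the second has the nonzero frequency - (b + 1) in ph. *)
case: a => [|a]; first by rewrite mul0r add0r (Eint_neq (p := 0) (q := b.+1))// !mulr0.
have -> : (a.+1 + b.+1 + c + 4 = (a + b + c + 4).+2)%N by lia.
have -> : (k.+1 + k.+1 = (k + k).+2)%N by lia.
have -> : (a.+1 + b.+1).+1 = (a + b).+3 by lia.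
rewrite !EintSS [a.+1.-1]/=.
have [ab|/Eint_neq ->] := eqVneq a b; last by rewrite !mulr0 addr0.
have [kk|/Eint_neq ->] := eqVneq (a + b + c + 4)%N (k + k)%N; last by rewrite !mul0r !mulr0 addr0.
have := Jint_rec_sin (a + b).+1 c.
(* Zero frequency in al means 2 k = a + b + c + 4, so the coefficient a + b + c + 3 of the
   recurrence is the 2 k - 1 of the derivative. *)
have -> : ((a + b).+1 + c).+2%:R = 2 * k%:R - 1 :> C.
  have : ((a + b).+1 + c).+2%:R + 1 = k%:R + k%:R :> C.
    by rewrite natr1 -natrD -kk; congr (_%:R); lia.
  by move=> h; rewrite mulr_natl mulr2n -h addrK.
have -> : (a + b).+2%:R = 2 * a.+1%:R :> C by rewrite -natrM -ab; congr (_%:R); lia.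
move: (Jint (a + b).+1 c) (Jint (a + b).+3 c) (Eint _ (k + k)) (Eint a b)
  ('i ^+ c) (a.+1%:R : C) (k%:R : C).
move=> J J' E1 E2 i A K h.
transitivity (2^-1 * (2 * A * J - (2 * K - 1) * J') * E1 * E2 * i); first by field.
by rewrite h; ring.
Qed.

(** Reflects the symmetry ph -> - ph of the cycle; here both sides vanish unless a = b. *)
Lemma Lint_mono_sym a b c k : Lint (mono a b c k) = Lint (mono b a c k).
Proof.
rewrite !Lint_mono [(b + a)%N]addnC; congr (_ * (_ * _)).
by have [->//|ab] := eqVneq a b; rewrite !Eint_neq// eq_sym.
Qed.

Lemma Lint_Dhalf_mono22 a b c k :
  Lint (fun Z => b%:R * mono a b.-1 c k Z + (2^-1 - k%:R) * mono a.+1 b c k.+1 Z) = 0.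
Proof.
have := Lint_Dhalf_mono11 b a c k.
rewrite !LintD; try exact/inPZ/inP_mono.
rewrite !LintZ; try exact: inP_mono.
by rewrite (Lint_mono_sym b.-1 a c k) (Lint_mono_sym b a.+1 c k.+1).
Qed.

Lemma Lint_Dhalf_mono12 a b c k :
  Lint (fun Z => c%:R * mono a b c.-1 k Z + (2 * k%:R - 1) * mono a b c.+1 k.+1 Z) = 0.
Proof.
rewrite LintD; try exact/inPZ/inP_mono.
rewrite !LintZ; try exact: inP_mono.
rewrite !Lint_mono.
have [ab|/Eint_neq ->] := eqVneq a b; last by rewrite !mulr0 addr0.
have -> : (k.+1 + k.+1 = (k + k).+2)%N by lia.
have := Jint_rec_cos (a + b).+1 c; case: c => [|c] /= h.
  (* For c = 0 only the term with a single cosine is left, and the recurrence says that its integral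
     is zero. *)
  have J0 : Jint (a + b).+1 1 = 0.
    by apply/eqP; have /esym/eqP := h; rewrite mul0r mulf_eq0 pnatr_eq0.
  by rewrite J0 !(mul0r, mulr0, addr0).
have -> : (a + b + c.+2 + 4 = (a + b + c + 4).+2)%N by lia.
rewrite !EintSS.
have [kk|/Eint_neq ->] := eqVneq (a + b + c + 4)%N (k + k)%N; last by rewrite !mul0r !mulr0 addr0.
move: h; have -> : ((a + b).+1 + c.+1).+1%:R = 2 * k%:R - 1 :> C.
  have : ((a + b).+1 + c.+1).+1%:R + 1 = k%:R + k%:R :> C.
    by rewrite natr1 -natrD -kk; congr (_%:R); lia.
  by move=> h; rewrite mulr_natl mulr2n -h addrK.
(* The two extra factors z12 of the second term bring i^2 = -1, the sign that makes the two terms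
   cancel. *)
rewrite !exprS; have i2 : 'i * ('i * 'i ^+ c) = - 'i ^+ c :> C.
  by rewrite mulrA -expr2 sqrCi mulN1r.
rewrite i2; move: (Jint _ c) (Jint _ c.+2) (Eint _ (k + k)) (Eint a b)
  ('i ^+ c) (c.+1%:R : C) (k%:R : C).
move=> J J' E1 E2 i A K h.
transitivity ((A * J - (2 * K - 1) * J') * E1 * E2 * i); first by ring.
by rewrite h; ring.
Qed.

Lemma inP_Ddet v : inP (Ddet v).
Proof.
rewrite /Ddet; apply: inP_add; [|apply: inPN]; apply: inP_add; apply: inP_mul;
  by [exact: inP_const|exact: inP_entry].
Qed.

Lemma inP_Dhalf v f : v^T = v -> inP f -> inP (Dhalf v f).
Proof.
move=> sv hf; apply: inP_add; first exact: inP_derive.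
apply: inP_mul => //; apply: inP_mul; last exact: inP_Ddet.
by apply/inPZ; exact: inP_invN.
Qed.

(** Stokes' theorem on the closed cycle: up to a constant this integrates d_v (N^(1/2) f) dZ^3,
    which is exact, N^(1/2) = zeta being single-valued there. The proof reduces by linearity to the
    three families of monomial identities. *)
Lemma Lint_Dhalf v f : v^T = v -> inP f -> Lint (Dhalf v f) = 0.
Proof.
move=> sv /inP_spanP; elim=> [x a b c k|f1 f2 s1 h1 s2 h2|f1 f2 e s h].
- have hm := inP_mono a b c k.
  have -> : Lint (Dhalf v (fun Z => x * mono a b c k Z)) =
      Lint (fun Z => x * Dhalf v (mono a b c k) Z).
    apply: eq_Lint => Z rZ; rewrite /Dhalf.
    rewrite (isD_derive (isDM (isD_cst v x) (inP_isD_derive sv hm)) rZ).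
    by rewrite mul0r add0r; ring.
  rewrite (LintZ _ (inP_Dhalf sv hm)).
  rewrite (eq_Lint (fun Z rZ => Dhalf_mono a b c k sv rZ)).
  have iM := inP_mono.
  have i2 y z a1 b1 c1 k1 a2 b2 c2 k2 :
    inP (fun Z => y * mono a1 b1 c1 k1 Z + z * mono a2 b2 c2 k2 Z).
    by apply: inP_add; apply: inPZ; exact: iM.
  rewrite (LintD (inPZ _ (i2 _ _ _ _ _ _ _ _ _ _))
    (inP_add (inPZ _ (i2 _ _ _ _ _ _ _ _ _ _)) (inPZ _ (i2 _ _ _ _ _ _ _ _ _ _)))).
  rewrite (LintD (inPZ _ (i2 _ _ _ _ _ _ _ _ _ _)) (inPZ _ (i2 _ _ _ _ _ _ _ _ _ _))).
  rewrite !(LintZ _ (i2 _ _ _ _ _ _ _ _ _ _)).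
  rewrite Lint_Dhalf_mono11 Lint_Dhalf_mono22 Lint_Dhalf_mono12.
  by rewrite !(mulr0, addr0).
- have p1 := spanP_inP s1; have p2 := spanP_inP s2.
  have := LintD (inP_Dhalf sv p1) (inP_Dhalf sv p2); rewrite h1 h2 addr0 => <-.
  apply: eq_Lint => Z rZ; rewrite /Dhalf.
  rewrite (isD_derive (isDD (inP_isD_derive sv p1) (inP_isD_derive sv p2)) rZ).
  by rewrite mulrDr addrACA.
- have E : Lint (Dhalf v f2) = Lint (Dhalf v f1); last exact: (etrans E h).
  apply: eq_Lint => Z rZ; rewrite /Dhalf (e Z rZ).
  by rewrite (isD_derive (isD_ext sv e (inP_isD_derive sv (spanP_inP s))) rZ).
Qed.

End Stokes.

(** * The two actions *)

Section Operators.
Variable R : realType.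
Local Notation C := R[i].
Local Notation M2 := 'M[C]_2.
Local Notation o0 := (ord0 : 'I_2).
Local Notation o1 := (ord_max : 'I_2).
Implicit Types (F g M : M2 -> M2) (v Z A B K N : M2).

Local Notation v11 := (mx2 1 0 0 0 : M2).
Local Notation v22 := (mx2 0 0 0 1 : M2).
Local Notation vt := (mx2 0 'i 'i 0 : M2).

Lemma sym_v11 : v11^T = v11. Proof. exact: trmx_mx2. Qed.
Lemma sym_v22 : v22^T = v22. Proof. exact: trmx_mx2. Qed.
Lemma sym_vt : vt^T = vt. Proof. exact: trmx_mx2. Qed.

Definition Dmx v F Z : M2 :=
  \matrix_(i, j) 'D_v ((fun W => F W i j) : M2 -> C^o) Z.
Definition Dhalfmx v F Z : M2 := \matrix_(i, j) Dhalf v (fun W => F W i j) Z.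

(** The coefficient of the t-derivative in Tr(M d); for symmetric M it is the t-coordinate of M, as
    z12 = i t. *)
Definition tcoef (M : M2) : C := - ('i / 2) * (M o0 o1 + M o1 o0).

Lemma DmxE v F Z i j : Dmx v F Z i j = 'D_v ((fun W => F W i j) : M2 -> C^o) Z.
Proof. by rewrite /Dmx mxE. Qed.

Lemma DhalfmxE v F Z i j : Dhalfmx v F Z i j = Dhalf v (fun W => F W i j) Z.
Proof. by rewrite /Dhalfmx mxE. Qed.

Lemma mxaddE A B i j : (A + B) i j = A i j + B i j. Proof. by rewrite mxE. Qed.
Lemma mxoppE A i j : (- A) i j = - A i j. Proof. by rewrite mxE. Qed.
Lemma mxtrE A i j : A^T i j = A j i. Proof. by rewrite mxE. Qed.

Lemma lin3E (a b c : C) A B K i j :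
  (a *: A + b *: B + c *: K) i j = a * A i j + b * B i j + c * K i j.
Proof. by rewrite !mxE. Qed.

Lemma mxtrace_mul_sym N (a b d : C) :
  \tr (N *m mx2 a b b d) = N o0 o0 * a + N o1 o1 * d + (N o0 o1 + N o1 o0) * b.
Proof. by rewrite mxtrace2E !mulmx2E !mx2E; ring. Qed.

Lemma trd_entry d N F Z i j : trd d N F Z i j = \tr (N *m d (fun W => F W i j) Z).
Proof. by rewrite /trd mxE. Qed.

Lemma tr_mul_dmx N (f : M2 -> C) Z : \tr (N *m dmx f Z) =
  N o0 o0 * 'D_v11 (f : M2 -> C^o) Z + N o1 o1 * 'D_v22 (f : M2 -> C^o) Z +
  tcoef N * 'D_vt (f : M2 -> C^o) Z.
Proof.
rewrite /dmx mxtrace_mul_sym /d11 /d22 /dt /tcoef.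
move: ('D_v11 _ Z) ('D_v22 _ Z) ('D_vt _ Z) ('i / 2) => x y z w.
by rewrite mulrA [_ * - w]mulrC.
Qed.

Lemma tr_mul_dmx_half N (f : M2 -> C) Z : regular_dom Z ->
  \tr (N *m dmx_half f Z) =
  N o0 o0 * Dhalf v11 f Z + N o1 o1 * Dhalf v22 f Z + tcoef N * Dhalf vt f Z.
Proof.
move=> rZ; rewrite /dmx_half /Dhalf.
have d v : 'D_v ((fun W => \det W) : M2 -> C^o) Z = Ddet v Z.
  exact: (isD_derive (isD_det v) rZ).
have := tr_mul_dmx N (fun W => \det W) Z; rewrite (d v11) (d v22) (d vt).
have := tr_mul_dmx N f Z.
move: ('D_v11 _ Z) ('D_v22 _ Z) ('D_vt _ Z) (tcoef N) => x y z w.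
move: (Ddet v11 Z) (Ddet v22 Z) (Ddet vt Z) (2^-1 * (\det Z)^-1) (f Z).
move=> p q r k u.
move: (dmx f Z) (dmx _ Z) => D1 D2 h1 h2.
rewrite mulmxDr raddfD /= -scalemxAr mxtraceZ h1 h2.
by ring.
Qed.

Lemma trd_dmxE N F Z : trd (@dmx R) N F Z =
  N o0 o0 *: Dmx v11 F Z + N o1 o1 *: Dmx v22 F Z + tcoef N *: Dmx vt F Z.
Proof.
apply/matrixP => i j; rewrite trd_entry tr_mul_dmx lin3E.
by congr (_ * _ + _ * _ + _ * _); exact: esym (DmxE _ _ _ _ _).
Qed.

Lemma trd_dmx_halfE N F Z : regular_dom Z -> trd (@dmx_half R) N F Z =
  N o0 o0 *: Dhalfmx v11 F Z + N o1 o1 *: Dhalfmx v22 F Z +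
  tcoef N *: Dhalfmx vt F Z.
Proof.
move=> rZ; apply/matrixP => i j; rewrite trd_entry (tr_mul_dmx_half _ _ rZ) lin3E.
by congr (_ * _ + _ * _ + _ * _); exact: esym (DhalfmxE _ _ _ _ _).
Qed.

Lemma inW_Dmx v F : v^T = v -> inW' F -> inW' (Dmx v F).
Proof.
by move=> sv hF i j; under eq_fun do rewrite DmxE; exact: (inP_derive sv (hF i j)).
Qed.

Lemma inW_Dhalfmx v F : v^T = v -> inW' F -> inW' (Dhalfmx v F).
Proof.
by move=> sv hF i j; under eq_fun do rewrite DhalfmxE; exact: (inP_Dhalf sv (hF i j)).
Qed.

Lemma inW_ext F g : (forall Z, regular_dom Z -> F Z = g Z) -> inW' F -> inW' g.
Proof. by move=> e hF i j; apply: inP_ext (hF i j) => Z rZ; rewrite e. Qed.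

Lemma inP_tcoef M : inW' M -> inP (fun Z => tcoef (M Z)).
Proof. by move=> hM; apply/inPZ/inP_add; exact: hM. Qed.

Lemma inW_trd_dmx M F : inW' M -> inW' F -> inW' (fun Z => trd (@dmx R) (M Z) F Z).
Proof.
move=> hM hF.
have h := inW_add (inW_add (inW_scale (hM o0 o0) (inW_Dmx sym_v11 hF))
  (inW_scale (hM o1 o1) (inW_Dmx sym_v22 hF)))
  (inW_scale (inP_tcoef hM) (inW_Dmx sym_vt hF)).
by apply: (inW_ext _ h) => Z _; rewrite trd_dmxE.
Qed.

Lemma inW_trd_dmx_half M F : inW' M -> inW' F ->
  inW' (fun Z => trd (@dmx_half R) (M Z) F Z).
Proof.
move=> hM hF.
have h := inW_add (inW_add (inW_scale (hM o0 o0) (inW_Dhalfmx sym_v11 hF))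
  (inW_scale (hM o1 o1) (inW_Dhalfmx sym_v22 hF)))
  (inW_scale (inP_tcoef hM) (inW_Dhalfmx sym_vt hF)).
by apply: (inW_ext _ h) => Z rZ; rewrite trd_dmx_halfE.
Qed.

Lemma inW_rho' X F : inW' F -> inW' (rho' X F).
Proof.
move=> hF; have hc := @inW_cst R; have hi := @inW_id R.
have hm := @inW_mul R; have ht := @inW_trd_dmx.
have hs := fun (c : C) => inW_scale (inP_const c) hF.
have hA A : inW' (rho'A A F).
  have h1 := ht _ _ (hm _ _ (hc A) hi) hF.
  have h2 := ht _ _ (hm _ _ hi (hc A^T)) hF.
  have h3 := inW_opp (inW_add (inW_add h1 h2) (hs (\tr (2 *: A)))).
  exact: inW_add (inW_add h3 (hm _ _ (hc A) hF)) (hm _ _ hF (hc A^T)).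
have hB B : inW' (rho'B B F) by exact: inW_opp (ht _ _ (hc B) hF).
have hC K : inW' (rho'C K F).
  have zk := hm _ _ hi (hc K).
  have h1 := ht _ _ (hm _ _ zk hi) hF.
  have h2 := inW_scale (inW_tr (inW_scale (inP_const 2) zk)) hF.
  have h3 := inW_opp (hm _ _ zk hF).
  have h4 := inW_opp (hm _ _ (hm _ _ hF (hc K)) hi).
  exact: inW_add (inW_add (inW_add h1 h2) h3) h4.
exact: inW_add (inW_add (hA _) (hB _)) (hC _).
Qed.

Lemma inW_rhos X F : inWs F -> inWs (rhos X F).
Proof.
move=> hF; have hc := @inW_cst R; have hi := @inW_id R.
have hm := @inW_mul R; have ht := @inW_trd_dmx_half.
have hs := fun (c : C) => inW_scale (inP_const c) hF.
have hA A : inW' (rhosA A F).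
  have h1 := ht _ _ (hm _ _ (hc A) hi) hF.
  have h2 := ht _ _ (hm _ _ hi (hc A^T)) hF.
  have h3 := inW_opp (inW_add (inW_add h1 h2) (hs (\tr A))).
  have h4 := inW_opp (hm _ _ hF (hc A)).
  have h5 := inW_opp (hm _ _ (hc A^T) hF).
  exact: inW_add (inW_add h3 h4) h5.
have hB B : inW' (rhosB B F) by exact: inW_opp (ht _ _ (hc B) hF).
have hC K : inW' (rhosC K F).
  have zk := hm _ _ hi (hc K).
  have h1 := ht _ _ (hm _ _ zk hi) hF.
  have h2 := inW_scale (inW_tr zk) hF.
  have h3 := hm _ _ (hm _ _ (hc K) hi) hF.
  have h4 := hm _ _ (hm _ _ hF hi) (hc K).
  exact: inW_add (inW_add (inW_add h1 h2) h3) h4.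
exact: inW_add (inW_add (hA _) (hB _)) (hC _).
Qed.

(** Leibniz rule for N^(1/2) Tr(F g) with the square root attached to g: F receives the plain
    derivative, as in [rho'], and g the twisted one, as in [rhos]. *)
Lemma Dhalf_tr_mul v F g Z : v^T = v -> inW' F -> inW' g -> regular_dom Z ->
  Dhalf v (fun W => \tr (F W *m g W)) Z =
  \tr (Dmx v F Z *m g Z) + \tr (F Z *m Dhalfmx v g Z).
Proof.
move=> sv hF hg rZ.
have dF i j := inP_isD_derive sv (hF i j); have dg i j := inP_isD_derive sv (hg i j).
have dm i k j := isDM (dF i k) (dg k j).
have dtr := isDD (isDD (dm o0 o0 o0) (dm o0 o1 o0)) (isDD (dm o1 o0 o1) (dm o1 o1 o1)).
have e : (fun W => \tr (F W *m g W)) = (fun W => F W o0 o0 * g W o0 o0 +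
   F W o0 o1 * g W o1 o0 + (F W o1 o0 * g W o0 o1 + F W o1 o1 * g W o1 o1)).
  by apply/funext => W; rewrite mxtrace2E !mulmx2E.
rewrite e /Dhalf (isD_derive dtr rZ) !mxtrace2E !mulmx2E !DmxE !DhalfmxE /Dhalf.
move: (2^-1 * _ * _) => k.
move: (F Z o0 o0) (F Z o0 o1) (F Z o1 o0) (F Z o1 o1) => f1 f2 f3 f4.
move: (g Z o0 o0) (g Z o0 o1) (g Z o1 o0) (g Z o1 o1) => g1 g2 g3 g4.
do 8![move: ('D_v _ Z) => ?].
by ring.
Qed.

Lemma Dhalf_mul v (f h h' : M2 -> C) Z : v^T = v -> inP f -> isD v h h' ->
  regular_dom Z ->
  Dhalf v (fun W => h W * f W) Z = h' Z * f Z + h Z * Dhalf v f Z.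
Proof.
move=> sv hf dh rZ; rewrite /Dhalf (isD_derive (isDM dh (inP_isD_derive sv hf)) rZ).
by move: ('D_v _ Z) (f Z) (h Z) (h' Z) (2^-1 * _ * _) => a b c d e; ring.
Qed.

(** The quadratic vector field W of the infinitesimal action on symmetric matrices: the first order
    part of both actions is Tr(W d). *)
Definition sp4_field A B K Z : M2 := Z *m K *m Z - (A *m Z + Z *m A^T) - B.
Definition sp4_field_D A K v Z : M2 :=
  v *m K *m Z + Z *m K *m v - (A *m v + v *m A^T).

Lemma inW_sp4_field A B K : inW' (sp4_field A B K).
Proof.
have hc := @inW_cst R; have hi := @inW_id R; have hm := @inW_mul R.
exact: inW_add (inW_add (hm _ _ (hm _ _ hi (hc K)) hi)
  (inW_opp (inW_add (hm _ _ (hc A) hi) (hm _ _ hi (hc A^T))))) (inW_opp (hc B)).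
Qed.

Lemma isD_sp4_field A B K v i j :
  isD v (fun Z => sp4_field A B K Z i j) (fun Z => sp4_field_D A K v Z i j).
Proof.
have e := @isD_entry R v; have c (x : C) := isD_cst v x.
have q k l := isDM (isDM (e i k) (c (K k l))) (e l j).
have a k := isDM (c (- A i k)) (e k j).
have b k := isDM (e i k) (c (- A j k)).
have := isDD (isDD (isDD (isDD (q o0 o0) (q o1 o0)) (isDD (q o0 o1) (q o1 o1)))
  (isDD (isDD (a o0) (a o1)) (isDD (b o0) (b o1)))) (c (- B i j)).
set f := (fun Z => _ + _); have -> : f = (fun Z => sp4_field A B K Z i j).
  apply/funext => Z; rewrite /f /sp4_field !(mxaddE, mxoppE) !mulmx2E !mxtrE.
  by ring.
apply: isD_eq => Z _ /=; rewrite /sp4_field_D !(mxaddE, mxoppE) !mulmx2E !mxtrE.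
by ring.
Qed.

Lemma isD_tcoef A B K v : isD v (fun Z => tcoef (sp4_field A B K Z))
  (fun Z => tcoef (sp4_field_D A K v Z)).
Proof.
have d := isDM (isD_cst v (- ('i / 2))) (isDD (isD_sp4_field A B K v o0 o1)
  (isD_sp4_field A B K v o1 o0)).
by apply: (isD_eq _ d) => Z _; rewrite mul0r add0r.
Qed.

Lemma sp4_field_div A K Z : K^T = K -> Z^T = Z ->
  sp4_field_D A K v11 Z o0 o0 + sp4_field_D A K v22 Z o1 o1 +
  tcoef (sp4_field_D A K vt Z) = 3 * (\tr (Z *m K) - \tr A).
Proof.
move=> /sym_entry sK /sym_entry sZ.
have E v i j : sp4_field_D A K v Z i j =
   (v i o0 * K o0 o0 + v i o1 * K o1 o0) * Z o0 j +
   (v i o0 * K o0 o1 + v i o1 * K o1 o1) * Z o1 j +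
   ((Z i o0 * K o0 o0 + Z i o1 * K o1 o0) * v o0 j +
   (Z i o0 * K o0 o1 + Z i o1 * K o1 o1) * v o1 j) -
   (A i o0 * v o0 j + A i o1 * v o1 j + (v i o0 * A j o0 + v i o1 * A j o1)).
  by rewrite /sp4_field_D !(mxaddE, mxoppE) !mulmx2E !mxtrE.
rewrite (mxtrace2E (Z *m K)) (mxtrace2E A) !mulmx2E /tcoef.
move: (mx2_00 1 0 0 (0 : C)) (mx2_01 1 0 0 (0 : C)) (mx2_10 1 0 0 (0 : C))
  (mx2_11 1 0 0 (0 : C)); move: v11 => v a1 a2 a3 a4.
move: (mx2_00 0 0 0 (1 : C)) (mx2_01 0 0 0 (1 : C)) (mx2_10 0 0 0 (1 : C))
  (mx2_11 0 0 0 (1 : C)); move: v22 => w b1 b2 b3 b4.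
move: (mx2_00 0 'i 'i (0 : C)) (mx2_01 0 'i 'i (0 : C)) (mx2_10 0 'i 'i (0 : C))
  (mx2_11 0 'i 'i (0 : C)); move: vt => u c1 c2 c3 c4.
rewrite (E v) (E w) !(E u).
rewrite !(a1, a2, a3, a4) !(b1, b2, b3, b4) !(c1, c2, c3, c4) !sK !sZ.
(* Tr(Z K) - Tr A in coordinates. The two diagonal directions together contribute 2 d and the
   t-direction - i^2 d. *)
pose d := Z o0 o0 * K o0 o0 + Z o0 o1 * K o0 o1 + Z o0 o1 * K o0 o1 +
  Z o1 o1 * K o1 o1 - A o0 o0 - A o1 o1.
transitivity (2 * d - 'i ^+ 2 * d); rewrite /d.
  by field.
by rewrite sqrCi; ring.
Qed.

Lemma tcoefD A B : tcoef (A + B) = tcoef A + tcoef B.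
Proof. by rewrite /tcoef !(mxaddE, mxoppE); ring. Qed.
Lemma tcoefN A : tcoef (- A) = - tcoef A.
Proof. by rewrite /tcoef !(mxaddE, mxoppE); ring. Qed.

(** By cyclicity of the trace, the left and right multiplications acting on U cancel those acting on
    V. Only scalars survive: 2 + 1 times Tr(Z K), and minus 2 + 1 times Tr A. *)
Lemma invariance_zero_order A K Z (U V : M2) :
  \tr ((- (\tr (2 *: A) *: U) + A *m U + U *m A^T +
        (\tr (2 *: (Z *m K)) *: U - Z *m K *m U - U *m K *m Z)) *m V) +
  \tr (U *m (- (\tr A *: V) - V *m A - A^T *m V +
        (\tr (Z *m K) *: V + K *m Z *m V + V *m Z *m K))) =
  3 * (\tr (Z *m K) - \tr A) * \tr (U *m V).
Proof.
rewrite !mxtraceZ !mulmxDl !mulmxDr !mulNmx !mulmxN -!scalemxAl -!scalemxAr.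
rewrite !raddfD /= !raddfN /= !mxtraceZ.
have -> : \tr (A *m U *m V) = \tr (U *m (V *m A)).
  by rewrite -mulmxA mxtrace_mulC mulmxA.
have -> : \tr (Z *m K *m U *m V) = \tr (U *m (V *m Z *m K)).
  by rewrite -mulmxA mxtrace_mulC !mulmxA.
rewrite !mulmxA; move: (\tr _) (\tr _) (\tr _) (\tr _) (\tr _) (\tr _) (\tr _).
by move=> a b c d e f h; ring.
Qed.

(** The product rule with all analysis abstracted away: x, y, z and x', y', z' stand for the
    derivatives of U = F and V = g, the w's for the components of the vector field, the d's for the
    terms of its divergence, and S1, S2 for the zeroth order parts. *)
Lemma invariance_algebra (x y z x' y' z' S1 S2 U V : M2) (w1 w2 w3 d1 d2 d3 : C) :
  \tr (S1 *m V) + \tr (U *m S2) = (d1 + d2 + d3) * \tr (U *m V) ->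
  \tr ((w1 *: x + w2 *: y + w3 *: z + S1) *m V) +
  \tr (U *m (w1 *: x' + w2 *: y' + w3 *: z' + S2)) =
  d1 * \tr (U *m V) + w1 * (\tr (x *m V) + \tr (U *m x')) +
  (d2 * \tr (U *m V) + w2 * (\tr (y *m V) + \tr (U *m y'))) +
  (d3 * \tr (U *m V) + w3 * (\tr (z *m V) + \tr (U *m z'))).
Proof.
move=> h; rewrite !mulmxDl !mulmxDr -!scalemxAl -!scalemxAr !raddfD /= !mxtraceZ.
have -> : \tr (S1 *m V) = (d1 + d2 + d3) * \tr (U *m V) - \tr (U *m S2).
  by rewrite -h addrK.
by ring.
Qed.

Lemma invariance_pointwise X A B K F g Z (f := fun W => \tr (F W *m g W)) :
  K^T = K -> X = block_mx A B K (- A^T) -> inW' F -> inW' g -> regular_dom Z ->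
  \tr (rho' X F Z *m g Z) + \tr (F Z *m rhos X g Z) =
  Dhalf v11 (fun W => sp4_field A B K W o0 o0 * f W) Z +
  Dhalf v22 (fun W => sp4_field A B K W o1 o1 * f W) Z +
  Dhalf vt (fun W => tcoef (sp4_field A B K W) * f W) Z.
Proof.
move=> sK -> hF hg rZ; have hf : inP f := inW_tr (inW_mul hF hg).
rewrite (Dhalf_mul sym_v11 hf (isD_sp4_field A B K _ _ _) rZ).
rewrite (Dhalf_mul sym_v22 hf (isD_sp4_field A B K _ _ _) rZ).
rewrite (Dhalf_mul sym_vt hf (isD_tcoef A B K _) rZ).
rewrite (Dhalf_tr_mul sym_v11 hF hg rZ) (Dhalf_tr_mul sym_v22 hF hg rZ).
rewrite (Dhalf_tr_mul sym_vt hF hg rZ).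
have dv := sp4_field_div A sK (proj1 rZ).
rewrite /rho' /rhos block_mxKul block_mxKur block_mxKdl.
(* [S1] and [S2] are the zeroth order parts of the two actions; [E1] and [E2] split off the
   derivative along the vector field. *)
pose S1 := - (\tr (2 *: A) *: F Z) + A *m F Z + F Z *m A^T +
        (\tr (2 *: (Z *m K)) *: F Z - Z *m K *m F Z - F Z *m K *m Z).
pose S2 := - (\tr A *: g Z) - g Z *m A - A^T *m g Z +
        (\tr (Z *m K) *: g Z + K *m Z *m g Z + g Z *m Z *m K).
pose W := sp4_field A B K Z.
have E1 : rho'A A F Z + rho'B B F Z + rho'C K F Z = W o0 o0 *: Dmx v11 F Z +
    W o1 o1 *: Dmx v22 F Z + tcoef W *: Dmx vt F Z + S1.
  rewrite /rho'A /rho'B /rho'C !trd_dmxE /S1 /W /sp4_field.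
  rewrite !(tcoefD, tcoefN) !(mxaddE, mxoppE).
  move: (Dmx _ _ _) (Dmx _ _ _) (Dmx _ _ _) => x y z.
  move: (_ *: F Z) (A *m F Z) (F Z *m A^T) (_ *: F Z)
    (Z *m K *m F Z) (F Z *m K *m Z).
  move=> a b c d e h.
  by apply/matrixP => i j; rewrite !(mxaddE, mxoppE, mxE); ring.
have E2 : rhosA A g Z + rhosB B g Z + rhosC K g Z = W o0 o0 *: Dhalfmx v11 g Z +
    W o1 o1 *: Dhalfmx v22 g Z + tcoef W *: Dhalfmx vt g Z + S2.
  rewrite /rhosA /rhosB /rhosC !trd_dmx_halfE// /S2 /W /sp4_field.
  rewrite !(tcoefD, tcoefN) !(mxaddE, mxoppE).
  move: (Dhalfmx _ _ _) (Dhalfmx _ _ _) (Dhalfmx _ _ _) => x y z.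
  move: (_ *: g Z) (g Z *m A) (A^T *m g Z) (_ *: g Z)
    (K *m Z *m g Z) (g Z *m Z *m K).
  move=> a b c d e h.
  by apply/matrixP => i j; rewrite !(mxaddE, mxoppE, mxE); ring.
have S12 : \tr (S1 *m g Z) + \tr (F Z *m S2) = 3 * (\tr (Z *m K) - \tr A) * f Z.
  exact: invariance_zero_order.
rewrite -dv in S12.
have T1 := congr1 (fun U => \tr (U *m g Z)) E1.
have T2 := congr1 (fun V => \tr (F Z *m V)) E2.
exact: (etrans (congr2 +%R T1 T2) (invariance_algebra _ _ _ _ _ _ _ _ _ S12)).
Qed.

End Operators.

(** * Invariance *)

Section Invariance.
Variable R : realType.
Local Notation M2 := 'M[R[i]]_2.

Lemma pairing_invariant X (F g : M2 -> M2) : sp4 X -> inW' F -> inWs g ->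
  pairing (rho' X F) g + pairing F (rhos X g) = 0.
Proof.
move=> [A [B [K [_ sK eX]]]] hF hg.
have hF' := inW_rho' X hF; have hg' := inW_rhos X hg.
have p1 := inW_tr (inW_mul hF' hg); have p2 := inW_tr (inW_mul hF hg').
rewrite (pairingE hF' hg) (pairingE hF hg') -mulrDr -(LintD p1 p2).
have hf := inW_tr (inW_mul hF hg).
have hW := @inW_sp4_field R A B K.
have q1 := inP_mul (hW ord0 ord0) hf.
have q2 := inP_mul (hW ord_max ord_max) hf.
have q3 := inP_mul (inP_tcoef hW) hf.
have d1 := inP_Dhalf (sym_v11 R) q1; have d2 := inP_Dhalf (sym_v22 R) q2.
have d3 := inP_Dhalf (sym_vt R) q3.
have z1 := Lint_Dhalf (sym_v11 R) q1; have z2 := Lint_Dhalf (sym_v22 R) q2.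
have z3 := Lint_Dhalf (sym_vt R) q3.
rewrite (eq_Lint (fun Z rZ => invariance_pointwise sK eX hF hg rZ)).
rewrite (LintD (inP_add d1 d2) d3) (LintD d1 d2) z1 z2 z3.
by rewrite !addr0 mulr0.
Qed.

End Invariance.

Theorem proposition89 (R : realType) :
  (* the operators act on the two spaces *)
  (forall (X : 'M[R[i]]_(2 + 2)) (F : 'M[R[i]]_2 -> 'M[R[i]]_2),
     sp4 X -> inW' F -> inW' (rho' X F)) /\
  (forall (X : 'M[R[i]]_(2 + 2)) (g : 'M[R[i]]_2 -> 'M[R[i]]_2),
     sp4 X -> inWs g -> inWs (rhos X g)) /\
  (* bilinearity *)
  (forall (a : R[i]) (F1 F2 g : 'M[R[i]]_2 -> 'M[R[i]]_2),
     inW' F1 -> inW' F2 -> inWs g ->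
     pairing (fun Z => a *: F1 Z + F2 Z) g = a * pairing F1 g + pairing F2 g) /\
  (forall (a : R[i]) (F g1 g2 : 'M[R[i]]_2 -> 'M[R[i]]_2),
     inW' F -> inWs g1 -> inWs g2 ->
     pairing F (fun Z => a *: g1 Z + g2 Z) = a * pairing F g1 + pairing F g2) /\
  (* non-degeneracy *)
  (forall F : 'M[R[i]]_2 -> 'M[R[i]]_2, inW' F ->
     (forall g, inWs g -> pairing F g = 0) ->
     forall Z, regular_dom Z -> F Z = 0) /\
  (forall g : 'M[R[i]]_2 -> 'M[R[i]]_2, inWs g ->
     (forall F, inW' F -> pairing F g = 0) ->
     forall Z, regular_dom Z -> g Z = 0) /\
  (* invariance *)
  (forall (X : 'M[R[i]]_(2 + 2)) (F g : 'M[R[i]]_2 -> 'M[R[i]]_2),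
     sp4 X -> inW' F -> inWs g ->
     pairing (rho' X F) g + pairing F (rhos X g) = 0).
Proof.
split; first by move=> X F _; exact: inW_rho'.
split; first by move=> X g _; exact: inW_rhos.
split; first exact: pairing_linear_l.
split; first exact: pairing_linear_r.
split; first exact: pairing_nondegenerate_l.
split; first exact: pairing_nondegenerate_r.
exact: pairing_invariant.
Qed.
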